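(* Let $\mathscr{H}$ be a reproducing kernel Hilbert space on a non-empty set $\Omega$. Let $A,B,C,D,X,Y\in \mathbb{B}(\mathscr{H})$, and let $\alpha \in [0,1]$. Then $$\left\|\frac{A^*XB+C^*YD}{2}\right\|^{2}_{ber} \leq \mathbf{ber}^{1/r}\left(\frac{(B^*|X|^{2\alpha }B)^r+(D^*|Y|^{2\alpha }D)^r}{2}\right)\mathbf{ber}^{1/s}\left(\frac{(A^*|X^*|^{2(1-\alpha)}A)^s +(C^*|Y^*|^{2(1-\alpha)}C)^s}{2}\right)$$ for all $r,s \geq 1$.
   Context: A reproducing kernel Hilbert space $\mathscr{H}$ on a non-empty set $\Omega$ is a Hilbert space of complex-valued functions on $\Omega$ such that for every $\lambda\in\Omega$ the evaluation map $f\mapsto f(\lambda)$ is a continuous linear functional on $\mathscr{H}$. For $\lambda\in\Omega$, $k_\lambda\in\mathscr{H}$ denotes the unique element with $f(\lambda)=\langle f,k_\lambda\rangle$ for all $f\in\mathscr{H}$; it is assumed that $k_\lambda\neq 0$ for all $\lambda\in\Omega$, and $\hat{k}_\lambda=k_\lambda/\|k_\lambda\|$ is the normalized reproducing kernel. $\mathbb{B}(\mathscr{H})$ is the algebra of bounded linear operators on $\mathscr{H}$. For $A\in\mathbb{B}(\mathscr{H})$, the Berezin number is $\mathbf{ber}(A)=\sup\{|\langle A\hat{k}_\lambda,\hat{k}_\lambda\rangle|:\lambda\in\Omega\}$ and the Berezin norm is $\|A\|_{ber}=\sup\{|\langle A\hat{k}_\lambda,\hat{k}_\mu\rangle|:\lambda,\mu\in\Omega\}$.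 $\mathbf{ber}^{t}(A)$ means $(\mathbf{ber}(A))^{t}$. $|A|=(A^*A)^{1/2}$, and real powers of positive operators are taken by continuous functional calculus (with $T^0=I$, the identity operator). *)

(* Defs.v *)
From HB Require Import structures.
From mathcomp Require Import all_boot all_order all_algebra.
From mathcomp Require Import all_classical all_reals all_analysis.
From mathcomp Require Export complex.

Set Implicit Arguments.
Unset Strict Implicit.
Unset Printing Implicit Defensive.

Import Order.TTheory GRing.Theory Num.Theory.
Import numFieldNormedType.Exports.

Local Open Scope classical_set_scope.
Local Open Scope ring_scope.
Local Open Scope complex_scope.

(* The norm of a normed module over R[i] takes its values in R[i].
   The form [inner] is linear in its first argument. *)
HB.mixin Record isHilbert (R : realType) (H : Type)
    of CompleteNormedModule R[i] H := {
  inner : {dot H for (@Num.conj R[i])} ;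
  sqr_norm_inner : forall x : H, `|x| ^+ 2 = inner x x }.

#[short(type="hilbertType")]
HB.structure Definition Hilbert (R : realType) :=
  {H of CompleteNormedModule R[i] H & isHilbert R H}.

(* A Hilbert space of functions on Omega: [evalf f] is the function denoted by
   the vector [f], and the vector space operations are the pointwise ones. *)
HB.mixin Record isRKHS (R : realType) (Omega : Type) (H : Type)
    of Hilbert R H := {
  evalf : H -> Omega -> R[i] ;
  evalf_inj : injective evalf ;
  evalf_linear : forall (a : R[i]) (f g : H) (l : Omega),
    evalf (a *: f + g) l = a * evalf f l + evalf g l ;
  evalf_continuous : forall l : Omega,
    continuous ((fun f : H => evalf f l) : H -> R[i]^o) }.

#[short(type="rkhsType")]
HB.structure Definition RKHS (R : realType) (Omega : Type) :=
  {H of Hilbert R H & isRKHS R Omega H}.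

Section Operators.
Context {R : realType} {H : hilbertType R}.
Implicit Types (T S : H -> H) (x y : H).

Definition bounded_op T : Prop := linear T /\ continuous T.

(* The element of B(H) determined by <T x, y> = <x, T^* y>. *)
Definition adjoint T : H -> H :=
  xget (fun=> 0) [set S | bounded_op S /\
                          forall x y, inner (T x) y = inner x (S y)].

Definition spectrum T : set R[i] :=
  [set z | ~ exists S, [/\ bounded_op S,
                         forall x, S (T x - z *: x) = x &
                         forall x, T (S x) - z *: S x = x]].

Definition poly_op (p : {poly R}) T : H -> H :=
  fun x => \sum_(i < size p) (p`_i)%:C *: iter i T x.

(* Continuous functional calculus, for T self-adjoint and f continuous on the
   (real) spectrum of T: f(T) is the limit in operator norm, that is, uniformly
   on the closed unit ball, of p_n(T), for real polynomials p_n that converge to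
   f uniformly on the spectrum of T. *)
Definition cfc (f : R -> R) T : H -> H :=
  xget (fun=> 0) [set S | bounded_op S /\ exists p : nat -> {poly R},
    {uniform [set t : R | spectrum T t%:C],
      (fun n t => (p n).[t]) @ \oo --> f} /\
    {uniform [set x : H | `|x| <= 1],
      (fun n => poly_op (p n) T) @ \oo --> S}].

(* T^a for T positive; since 0 `^ 0 = 1, this gives T^0 = I. *)
Definition op_power T (a : R) : H -> H := cfc (fun t => t `^ a) T.

Definition op_abs T : H -> H := op_power (adjoint T \o T) 2^-1.

End Operators.

Section Berezin.
Context {R : realType} {Omega : Type} {H : rkhsType R Omega}.

Definition rep_kernel (l : Omega) : H :=
  xget 0 [set k : H | forall f : H, evalf f l = inner f k].

Definition normalized_kernel (l : Omega) : H :=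
  `|rep_kernel l|^-1 *: rep_kernel l.

Definition berezin_number (T : H -> H) : R :=
  sup [set Normc.normc (inner (T (normalized_kernel l)) (normalized_kernel l))
      | l in [set: Omega]].

Definition berezin_norm (T : H -> H) : R :=
  sup [set Normc.normc (inner (T (normalized_kernel l)) (normalized_kernel m))
      | l in [set: Omega] & m in [set: Omega]].

End Berezin.

(* Main.v *)
(** For unit vectors k, m, pulling the adjoints through the form gives the entry
    <X B k, A m> + <Y D k, C m>. Each summand is bounded by the mixed Schwarz
    inequality
      |<X x, y>|^2 <= <|X|^(2 alpha) x, x> <|X^*|^(2 (1 - alpha)) y, y>,
    the two are combined by Cauchy-Schwarz, and each of the two resulting means
    (a + b) / 2 is bounded by ((a^r + b^r) / 2)^(1/r), where
    <P k, k>^r <= <P^r k, k> for positive P (McCarthy).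

    All of this rests on the functional calculus of a bounded self-adjoint T.
    Its key point is that a real polynomial p which is nonnegative on the real
    spectrum of T gives a positive operator p(T). If the infimum l of the form
    of p(T) were negative, p - l would have no root in the spectrum, so all its
    linear factors over the complex numbers would be bounded below at T, hence
    also p(T) - l; but p(T) - l is positive and is not bounded below. *)

Require Import Defs.
From HB Require Import structures.
From mathcomp Require Import all_boot all_order all_algebra.
From mathcomp Require Import all_classical all_reals all_analysis.
From mathcomp Require Import ring lra.

Set Implicit Arguments.
Unset Strict Implicit.
Unset Printing Implicit Defensive.

Import Order.TTheory GRing.Theory Num.Theory.
Import numFieldNormedType.Exports.

Local Open Scope classical_set_scope.
Local Open Scope ring_scope.
Local Open Scope complex_scope.

(** * Real-valued norm and real part of the inner product *)

Section HilbertBasics.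
Context {R : realType} {H : hilbertType R}.
Implicit Types (x y z : H) (a : R) (c : R[i]) (T S : H -> H).

(** [adjoint] and [cfc] are picked by choice from a specification, so neither is usable before
    existence is proved, nor [cfc] identified before uniqueness. Adjoints and inverses both come
    from one variational lemma, [coercive_form_repr]. Uniqueness and the norm bound of the
    functional calculus come from positivity applied to d^2 - p^2. Functions are always approximated
    on an interval [0, M] that contains the spectrum, so compositions of powers and transport from
    X^* X to X X^* need only one polynomial valid on a large enough interval, not a spectral mapping
    theorem. The square roots vanish at once, since |X|^(2 alpha) = (X^* X)^alpha. *)

Definition nm x : R := complex.Re `|x|.
(** Real parts keep all estimates in the totally ordered field [R]; [inner_ripE] recovers the
    complex form. *)
Definition rip x y : R := complex.Re (inner x y).

Lemma nmE x : `|x| = (nm x)%:C.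
Proof. by rewrite /nm RRe_real// ger0_real. Qed.

Lemma nm_ge0 x : 0 <= nm x.
Proof. by rewrite -ler0c -nmE. Qed.

Lemma nm0 : nm 0 = 0.
Proof. by rewrite /nm normr0. Qed.

Lemma nm_eq0 x : nm x = 0 -> x = 0.
Proof. by move=> h; apply/eqP; rewrite -normr_eq0 nmE h. Qed.

Lemma nm_gt0 x : x != 0 -> 0 < nm x.
Proof. by move=> x0; rewrite -ltcR -nmE normr_gt0. Qed.

Lemma nmD x y : nm (x + y) <= nm x + nm y.
Proof. by rewrite -lecR rmorphD/= -!nmE ler_normD. Qed.

Lemma nmN x : nm (- x) = nm x.
Proof. by rewrite /nm normrN. Qed.

Lemma nmB x y : nm (x - y) = nm (y - x).
Proof. by rewrite /nm distrC. Qed.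

Lemma normr_normc c : `|c| = (Normc.normc c)%:C.
Proof. by case: c. Qed.

Lemma nmZ c x : nm (c *: x) = Normc.normc c * nm x.
Proof. by apply: complexI; rewrite rmorphM/= -!nmE -normr_normc normrZ. Qed.

Lemma normc_real a : Normc.normc a%:C = `|a|.
Proof. by rewrite /= expr0n addr0 sqrtr_sqr. Qed.

Lemma nmZr a x : nm (a%:C *: x) = `|a| * nm x.
Proof. by rewrite nmZ normc_real. Qed.

Lemma innerC x y : inner x y = conjc (inner y x).
Proof. by have := hermC (@inner R H) x y; rewrite /= expr0 mul1r. Qed.

Lemma innerDl x y z : inner (x + y) z = inner x z + inner y z.
Proof. exact: linearDl. Qed.

Lemma innerDr x y z : inner z (x + y) = inner z x + inner z y.
Proof. exact: linearDr. Qed.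

Lemma innerZl c x z : inner (c *: x) z = c * inner x z.
Proof. exact: linearZl_LR. Qed.

Lemma innerZr c x z : inner z (c *: x) = conjc c * inner z x.
Proof. exact: linearZr_LR. Qed.

Lemma innerNl x z : inner (- x) z = - inner x z.
Proof. exact: linearNl. Qed.

Lemma innerNr x z : inner z (- x) = - inner z x.
Proof. exact: linearNr. Qed.

Lemma ReD c d : complex.Re (c + d) = complex.Re c + complex.Re d.
Proof. by case: c; case: d. Qed.

Lemma ripC x y : rip x y = rip y x.
Proof. by rewrite /rip innerC; case: (inner y x). Qed.

Lemma ripDl x y z : rip (x + y) z = rip x z + rip y z.
Proof. by rewrite /rip innerDl ReD. Qed.

Lemma ripDr x y z : rip z (x + y) = rip z x + rip z y.
Proof. by rewrite /rip innerDr ReD. Qed.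

Lemma ripNl x z : rip (- x) z = - rip x z.
Proof. by rewrite /rip innerNl; case: (inner x z). Qed.

Lemma ripNr x z : rip z (- x) = - rip z x.
Proof. by rewrite ripC ripNl ripC. Qed.

Lemma ripZl a x z : rip (a%:C *: x) z = a * rip x z.
Proof. by rewrite /rip innerZl; case: (inner x z) => u v /=; rewrite mul0r subr0. Qed.

Lemma ripZr a x z : rip z (a%:C *: x) = a * rip z x.
Proof. by rewrite ripC ripZl ripC. Qed.

Lemma ripxx x : rip x x = nm x ^+ 2.
Proof.
have := sqr_norm_inner x; rewrite nmE -rmorphXn/= /rip => <-.
by [].
Qed.

Lemma rip_ext x y : (forall z, rip z x = rip z y) -> x = y.
Proof.
move=> h; apply/eqP; rewrite -subr_eq0; apply/eqP/nm_eq0.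
by apply/eqP; rewrite -sqrf_eq0 -ripxx ripDr ripNr h subrr.
Qed.

End HilbertBasics.

(** * Bounded operators *)

Section BoundedOperators.
Context {R : realType} {H : hilbertType R}.
Implicit Types (x y z : H) (a : R) (c : R[i]) (T S Q : H -> H).

Definition symop T := forall x y, inner (T x) y = inner x (T y).
Definition posop T := forall x, 0 <= rip (T x) x.

(** Discriminant inequality. Besides Cauchy-Schwarz, it serves with p = 0, where it turns a
    first-order condition into q = 0. *)
Lemma sqr_le_mul_of_quad (p q r : R) : 0 <= r ->
  (forall t, 0 <= p + 2 * q * t + r * t ^+ 2) -> q ^+ 2 <= p * r.
Proof.
rewrite le_eqVlt => /orP[/eqP <-|r0] h.
  rewrite mulr0; have [->|q0] := eqVneq q 0; first by rewrite expr0n.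
  (* For r = 0 the function is affine with nonzero slope; at this point it equals -1. *)
  have := h (- (p + 1) / (2 * q)).
  have -> : p + 2 * q * (- (p + 1) / (2 * q)) + 0 * (- (p + 1) / (2 * q)) ^+ 2 = -1
    by field.
  by rewrite ler0N1.
have := h (- q / r).
have -> : p + 2 * q * (- q / r) + r * (- q / r) ^+ 2 = (p * r - q ^+ 2) / r.
  by field; rewrite gt_eqF.
by rewrite pmulr_lge0 ?invr_gt0// subr_ge0.
Qed.

Section Linear.
Variable T : H -> H.
Hypothesis linT : linear T.

Lemma linopD x y : T (x + y) = T x + T y.
Proof. by have := linT 1 x y; rewrite !scale1r. Qed.

Lemma linop0 : T 0 = 0.
Proof. by apply: (addrI (T 0)); rewrite -linopD !addr0. Qed.

Lemma linopZ c x : T (c *: x) = c *: T x.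
Proof. by rewrite -[c *: x]addr0 linT linop0 addr0. Qed.

Lemma linopN x : T (- x) = - T x.
Proof. by rewrite -scaleN1r linopZ scaleN1r. Qed.

Lemma linopB x y : T (x - y) = T x - T y.
Proof. by rewrite linopD linopN. Qed.

Lemma bounded_opI (K : R) : (forall x, nm (T x) <= K * nm x) -> bounded_op T.
Proof.
move=> hK; split=> //.
pose f : {linear H -> H} := HB.pack T (@GRing.isLinear.Build _ _ _ _ T linT).
apply: (@bounded_linear_continuous _ _ _ f).
apply/linear_boundedP; exists K%:C; split.
  by apply/complex_realP; exists K.
move=> M KM x /=; rewrite nmE.
apply: (@le_trans _ _ (K%:C * `|x|)).
  by rewrite nmE -rmorphM lecR.
by rewrite ler_wpM2r// ltW.
Qed.

End Linear.

Lemma bounded_op_linear T : bounded_op T -> linear T.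
Proof. by case. Qed.

Lemma bounded_op_bound T : bounded_op T ->
  exists2 K : R, 0 < K & forall x, nm (T x) <= K * nm x.
Proof.
move=> [linT contT].
pose f : {linear H -> H} := HB.pack T (@GRing.isLinear.Build _ _ _ _ T linT).
have /linear_boundedP : bounded_near f (nbhs (0 : H)).
  by apply: continuous_linear_bounded; exact: contT.
move=> /pinfty_ex_gt0[M M0 hM].
exists (complex.Re M); first by move: M0; rewrite ltcE => /andP[].
move=> x; have := hM x; rewrite /= !nmE.
have -> : M = (complex.Re M)%:C by rewrite RRe_real// gtr0_real.
by rewrite -rmorphM lecR.
Qed.

Lemma linear_id : linear (id : H -> H).
Proof. by move=> c x y. Qed.

Lemma linear_comp T S : linear T -> linear S -> linear (T \o S).
Proof. by move=> lT lS c x y /=; rewrite lS lT. Qed.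

Lemma linear_add T S : linear T -> linear S -> linear (fun x => T x + S x).
Proof. by move=> lT lS c x y /=; rewrite lS lT scalerDr addrACA. Qed.

Lemma linear_scale (d : R[i]) T : linear T -> linear (fun x => d *: T x).
Proof. by move=> lT c x y /=; rewrite lT scalerDr !scalerA mulrC. Qed.

Lemma bounded_op_id : bounded_op (id : H -> H).
Proof. by apply: (@bounded_opI _ linear_id 1) => x; rewrite mul1r. Qed.

Lemma bounded_op_comp T S : bounded_op T -> bounded_op S -> bounded_op (T \o S).
Proof.
move=> bT bS; have [K K0 hK] := bounded_op_bound bT.
have [L L0 hL] := bounded_op_bound bS.
apply: (@bounded_opI _ (linear_comp (proj1 bT) (proj1 bS)) (K * L)) => x /=.
by rewrite (le_trans (hK _))// -mulrA ler_wpM2l// ltW.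
Qed.

Lemma bounded_op_add T S :
  bounded_op T -> bounded_op S -> bounded_op (fun x => T x + S x).
Proof.
move=> bT bS; have [K K0 hK] := bounded_op_bound bT.
have [L L0 hL] := bounded_op_bound bS.
apply: (@bounded_opI _ (linear_add (proj1 bT) (proj1 bS)) (K + L)) => x /=.
by rewrite (le_trans (nmD _ _))// mulrDl lerD.
Qed.

Lemma bounded_op_scale (d : R[i]) T :
  bounded_op T -> bounded_op (fun x => d *: T x).
Proof.
move=> bT; have [K K0 hK] := bounded_op_bound bT.
apply: (@bounded_opI _ (linear_scale d (proj1 bT)) (Normc.normc d * K)) => x /=.
rewrite nmZ -mulrA ler_wpM2l//.
by rewrite -ler0c -normr_normc.
Qed.

Lemma symop_rip T x y : symop T -> rip (T x) y = rip x (T y).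
Proof. by move=> sT; rewrite /rip sT. Qed.

Lemma rip_quad T x y (t : R) : linear T -> symop T ->
  rip (T (x + t%:C *: y)) (x + t%:C *: y) =
  rip (T x) x + 2 * rip (T x) y * t + rip (T y) y * t ^+ 2.
Proof.
move=> lT sT; rewrite linopD// linopZ// !ripDl !ripDr !ripZl !ripZr.
rewrite (ripC (T y) x) -symop_rip//; ring.
Qed.

Lemma posop_cauchy_schwarz T x y : linear T -> symop T -> posop T ->
  rip (T x) y ^+ 2 <= rip (T x) x * rip (T y) y.
Proof.
move=> lT sT pT; apply: sqr_le_mul_of_quad => // t.
by rewrite -rip_quad.
Qed.

Lemma normc_sqr c : Normc.normc c ^+ 2 = complex.Re (conjc c * c).
Proof.
case: c => u v /=; rewrite sqr_sqrtr ?addr_ge0 ?sqr_ge0//; ring.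
Qed.

Lemma normc_ge0 c : 0 <= Normc.normc c.
Proof. by rewrite -ler0c -normr_normc. Qed.

Lemma posop_cauchy_schwarzc T x y : linear T -> symop T -> posop T ->
  Normc.normc (inner (T x) y) ^+ 2 <= rip (T x) x * rip (T y) y.
Proof.
move=> lT sT pT; set w := inner (T x) y.
have [w0|w0] := eqVneq (Normc.normc w) 0.
  by rewrite w0 expr0n mulr_ge0.
(* Multiplying x by the conjugate of w makes the form real, so the real inequality applies; one
   factor |w|^2 cancels at the end. *)
have h1 : rip (T (conjc w *: x)) y = Normc.normc w ^+ 2.
  by rewrite /rip linopZ// innerZl normc_sqr.
have h2 : rip (T (conjc w *: x)) (conjc w *: x) = Normc.normc w ^+ 2 * rip (T x) x.
  rewrite /rip linopZ// innerZl innerZr conjcK mulrA.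
  have -> : conjc w * w = (Normc.normc w ^+ 2)%:C.
    by rewrite rmorphXn/= -normr_normc sqr_normc mulrC.
  by case: (inner (T x) x) => u v /=; rewrite mul0r subr0.
have := @posop_cauchy_schwarz T (conjc w *: x) y lT sT pT.
rewrite h1 h2 -mulrA [X in X <= _]expr2 ler_pM2l// exprn_gt0//.
by rewrite lt_def w0 normc_ge0.
Qed.

Lemma normc_inner_le x y : Normc.normc (inner x y) <= nm x * nm y.
Proof.
rewrite -(@ler_pXn2r _ 2)// ?nnegrE ?normc_ge0 ?mulr_ge0 ?nm_ge0//.
rewrite exprMn -!ripxx; apply: (@posop_cauchy_schwarzc id) => //.
by move=> z; rewrite ripxx sqr_ge0.
Qed.

Lemma Re_le_normc c : `|complex.Re c| <= Normc.normc c.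
Proof. by rewrite -lecR -normr_normc normc_ge_Re. Qed.

Lemma norm_rip_le x y : `|rip x y| <= nm x * nm y.
Proof. exact: le_trans (Re_le_normc _) (normc_inner_le _ _). Qed.

Lemma rip_le x y : rip x y <= nm x * nm y.
Proof. exact: le_trans (ler_norm _) (norm_rip_le _ _). Qed.

Lemma cauchy_lim (u : nat -> H) :
  (forall e : R, 0 < e -> exists N, forall m n, (N <= m)%N -> (N <= n)%N ->
     nm (u m - u n) <= e) ->
  exists l, forall e : R, 0 < e -> exists N, forall n, (N <= n)%N -> nm (u n - l) <= e.
Proof.
move=> cu.
have : cauchy (u @ \oo).
  apply: cauchy_exP => e e0.
  (* Radii live in [R[i]], but a positive one is real. Half of it is used because balls are
     strict. *)
  have e'0 : 0 < complex.Re e by move: e0; rewrite ltcE => /andP[].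
  have eE : e = (complex.Re e)%:C by rewrite RRe_real// gtr0_real.
  have [N hN] := cu (complex.Re e / 2) (divr_gt0 e'0 (ltr0Sn _ 1)).
  exists (u N); exists N => // n /= Nn.
  rewrite -ball_normE /= nmE eE ltcR (le_lt_trans (hN _ _ _ Nn))//.
  by rewrite gtr_pMr// invf_lt1// ltr1n.
move=> /cauchy_cvgP/cvg_ex[l ul]; exists l => e e0.
have eC : 0 < e%:C by rewrite ltcR.
have /cvgrPdist_lt/(_ _ eC)[N _ hN] := ul.
exists N => n Nn; have := hN n Nn.
by rewrite /= nmE ltcR nmB => /ltW.
Qed.

End BoundedOperators.

(** * Coercive forms, adjoints and inverses *)

Section LaxMilgram.
Context {R : realType} {H : hilbertType R}.
Implicit Types (x y z : H) (a : R) (c : R[i]) (T S Q : H -> H).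

Lemma invS_small (d : R) : 0 < d -> exists N, forall n, (N <= n)%N -> n.+1%:R^-1 <= d.
Proof.
move=> d0; exists (Num.truncn d^-1) => n Nn.
rewrite -[leRHS]invrK lef_pV2 ?posrE ?invr_gt0//.
rewrite (le_trans (ltW (truncnS_gt _)))// ler_nat ltnS//.
Qed.

(** A symmetric Lax-Milgram argument by energy minimization. With [Q = id] it is the Riesz theorem
    behind adjoints; with [phi = rip y] it solves Q u = y. Only real linearity of [phi] is asked
    for, to match [rip]. *)
Lemma coercive_form_repr Q (c L : R) (phi : H -> R) :
  bounded_op Q -> symop Q -> 0 < c -> (forall x, c * nm x ^+ 2 <= rip (Q x) x) ->
  (forall x y, phi (x + y) = phi x + phi y) ->
  (forall a x, phi (a%:C *: x) = a * phi x) ->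
  0 <= L -> (forall x, `|phi x| <= L * nm x) ->
  exists u, forall v, phi v = rip (Q u) v.
Proof.
move=> bQ sQ c0 hc phiD phiZ L0 hL.
have lQ := bounded_op_linear bQ.
have [K K0 hK] := bounded_op_bound bQ.
(* The representing vector is the limit of a minimizing sequence of [J]. *)
pose J x := rip (Q x) x - 2 * phi x.
have J_quad x y t : J (x + t%:C *: y) =
    J x + 2 * (rip (Q x) y - phi y) * t + rip (Q y) y * t ^+ 2.
  by rewrite /J rip_quad// phiD phiZ; ring.
have Jlb x : - (L ^+ 2 / c) <= J x.
  have h1 := hc x; have h2 : phi x <= L * nm x := le_trans (ler_norm _) (hL x).
  rewrite /J; suff : 0 <= c * nm x ^+ 2 - 2 * (L * nm x) + L ^+ 2 / c by lra.
  have -> : c * nm x ^+ 2 - 2 * (L * nm x) + L ^+ 2 / c = (c * nm x - L) ^+ 2 / c.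
    by field; rewrite gt_eqF.
  by rewrite divr_ge0 ?sqr_ge0// ltW.
pose E : set R := [set J x | x in [set: H]].
have hE : has_inf E.
  split; first by exists (J 0); exists 0.
  by exists (- (L ^+ 2 / c)) => _ [x _ <-].
pose I := inf E.
have JI x : I <= J x by apply: ge_inf; [case: hE | exists x].
have /choice[u hu] : forall n, exists x, J x < I + n.+1%:R^-1.
  move=> n.
  have e0 : 0 < n.+1%:R^-1 :> R by rewrite invr_gt0.
  by have [_ [x _ <-] hx] := inf_adherent e0 hE; exists x.
(* Parallelogram argument: the midpoint of two near-minimizers cannot go below the infimum, which
   bounds the form at their difference. *)
have dist m n : c * nm (u m - u n) ^+ 2 <= 2 * m.+1%:R^-1 + 2 * n.+1%:R^-1.
  rewrite (le_trans (hc _))//.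
  have h1 := J_quad (u n) (u m - u n) 2^-1.
  have h2 := J_quad (u n) (u m - u n) 1.
  rewrite rmorph1 scale1r subrKC in h2.
  have := JI (u n + (2^-1)%:C *: (u m - u n)).
  have := hu m; have := hu n; rewrite h1 h2; clear.
  move: (m.+1%:R^-1) (n.+1%:R^-1) I (J _) (rip _ _) (rip _ _ - phi _) => a b I j q p.
  lra.
have [l hl] : exists l, forall e : R, 0 < e ->
    exists N, forall n, (N <= n)%N -> nm (u n - l) <= e.
  apply: cauchy_lim => e e0.
  have d0 : 0 < c * e ^+ 2 / 4 by rewrite divr_gt0 ?mulr_gt0 ?exprn_gt0.
  have [N hN] := invS_small d0; exists N => m n Nm Nn.
  rewrite -(@ler_pXn2r _ 2)// ?nnegrE ?nm_ge0 ?(ltW e0)// -(ler_pM2l c0).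
  rewrite (le_trans (dist m n))//; have := hN _ Nm; have := hN _ Nn; clear.
  move: (m.+1%:R^-1) (n.+1%:R^-1) (c * _) => a b d; lra.
exists l => v.
apply/eqP; rewrite eq_sym -subr_eq0 -sqrf_eq0 eq_le sqr_ge0 andbT.
(* First-order condition: 2 D t + <Q v, v> t^2 >= 0 for all t forces D = 0. It is derived at [u n]
   for large n, up to an arbitrary d, rather than from continuity of [J] at [l]. *)
rewrite -[X in _ <= X](mul0r (rip (Q v) v)).
apply: sqr_le_mul_of_quad; first by rewrite (le_trans _ (hc v))// mulr_ge0 ?sqr_ge0 ?ltW.
move=> t; rewrite add0r; set D := rip (Q l) v - phi v.
apply/ler_addgt0Pr => d d0.
have d20 : 0 < d / 2 by rewrite divr_gt0.
have B0 : 0 <= 2 * `|t| * K * nm v by rewrite !mulr_ge0 ?nm_ge0 ?(ltW K0).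
have e0 : 0 < d / 2 / (2 * `|t| * K * nm v + 1) by rewrite divr_gt0// ltr_wpDl.
have [N1 hN1] := invS_small d20; have [N2 hN2] := hl _ e0.
pose n := maxn N1 N2.
have {hN1} h1 := hN1 n (leq_maxl _ _); have {hN2} h2 := hN2 n (leq_maxr _ _).
have := JI (u n + t%:C *: v); rewrite J_quad => h3.
have h4 := hu n.
have h5 : `|2 * t * (rip (Q (u n)) v - rip (Q l) v)| <= d / 2.
  have -> : rip (Q (u n)) v - rip (Q l) v = rip (Q (u n - l)) v.
    by rewrite linopB// ripDl ripNl.
  rewrite !normrM ger0_norm//.
  have h6 : `|rip (Q (u n - l)) v| <= K * nm (u n - l) * nm v.
    by rewrite (le_trans (norm_rip_le _ _))// ler_wpM2r ?nm_ge0.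
  have h7 : 2 * `|t| * K * nm v * nm (u n - l) <= d / 2.
    rewrite (le_trans (ler_wpM2l B0 h2))// mulrCA ger_pMr//.
    by rewrite ler_pdivrMr ?mul1r ?lerDl// ltr_wpDl.
  apply: le_trans h7; rewrite (le_trans (ler_wpM2l _ h6)) ?mulr_ge0//.
  by rewrite le_eqVlt; apply/orP; left; apply/eqP; ring.
have {}h5 := le_trans (ler_norm _) h5.
have -> : 2 * D * t = 2 * (rip (Q (u n)) v - phi v) * t
   - 2 * t * (rip (Q (u n)) v - rip (Q l) v) by rewrite /D; ring.
move: h1 h3 h4 h5; clear.
move: (n.+1%:R^-1) I (J _) (_ * t) (2 * t * _) (_ * t ^+ 2) => a I j p q r; lra.
Qed.

(** Shows that a vector representing the real part of a complex linear functional represents the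
    functional itself. *)
Lemma inner_ripE x y : inner x y = rip x y -i* rip ('i *: x) y.
Proof.
rewrite /rip innerZl; case: (inner x y) => u v /=.
by rewrite mul0r sub0r mul1r opprK.
Qed.

Lemma adjoint_exists T : bounded_op T ->
  exists S, bounded_op S /\ forall x y, inner (T x) y = inner x (S y).
Proof.
move=> bT; have lT := bounded_op_linear bT.
have [K K0 hK] := bounded_op_bound bT.
have repr y : exists u, forall v, rip (T v) y = rip u v.
  apply: (@coercive_form_repr id 1 (K * nm y)) => //.
  - exact: bounded_op_id.
  - by move=> x; rewrite mul1r ripxx.
  - by move=> u v; rewrite linopD// ripDl.
  - by move=> a u; rewrite linopZ// ripZl.
  - by rewrite mulr_ge0 ?nm_ge0// ltW.
  - by move=> x; rewrite (le_trans (norm_rip_le _ _))// mulrAC ler_wpM2r ?nm_ge0.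
have [S hS] := choice repr.
have hin x y : inner (T x) y = inner x (S y).
  by rewrite !inner_ripE -linopZ// !hS !(ripC (S y)).
have innerI u v : (forall z, inner z u = inner z v) -> u = v.
  by move=> h; apply: rip_ext => z; rewrite /rip h.
exists S; split => //; apply: (@bounded_opI _ _ _ _ K).
  move=> c x y; apply: innerI => z.
  by rewrite -hin innerDr !innerZr innerDr innerZr !hin.
move=> y; have [->|S0] := eqVneq (S y) 0; first by rewrite nm0 mulr_ge0 ?nm_ge0 ?ltW.
(* The bound follows from |S y|^2 = Re <T (S y), y> after division by |S y|. *)
rewrite -(ler_pM2l (nm_gt0 S0)) -expr2 -ripxx -hS.
by rewrite (le_trans (rip_le _ _))// mulrCA mulrA ler_wpM2r ?nm_ge0.
Qed.

Lemma adjointP T : bounded_op T -> bounded_op (adjoint T) /\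
  forall x y, inner (T x) y = inner x (adjoint T y).
Proof.
move=> bT; rewrite /adjoint.
by apply: (@xgetPex _ _ [set S | bounded_op S /\
  forall x y, inner (T x) y = inner x (S y)]); exact: adjoint_exists.
Qed.

Lemma bounded_op_adjoint T : bounded_op T -> bounded_op (adjoint T).
Proof. by move=> /adjointP[]. Qed.

Lemma inner_adjoint T x y : bounded_op T -> inner (T x) y = inner x (adjoint T y).
Proof. by move=> /adjointP[]. Qed.

Lemma inner_adjointl T x y : bounded_op T -> inner (adjoint T x) y = inner x (T y).
Proof. by move=> bT; rewrite innerC -inner_adjoint// -innerC. Qed.

Lemma adjointK T : bounded_op T -> adjoint (adjoint T) = T.
Proof.
move=> bT; apply/funext => x; apply: rip_ext => z.
rewrite /rip -inner_adjoint ?inner_adjointl//.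
exact: bounded_op_adjoint.
Qed.

(** Representing the functionals <y, .> gives a right inverse; coercivity makes Q injective, so it
    is two-sided and linear, and bounds it by 1/c. *)
Lemma coercive_inverse Q (c : R) :
  bounded_op Q -> symop Q -> 0 < c -> (forall x, c * nm x ^+ 2 <= rip (Q x) x) ->
  exists S, [/\ bounded_op S, cancel S Q & cancel Q S].
Proof.
move=> bQ sQ c0 hc; have lQ := bounded_op_linear bQ.
have repr y : exists u, forall v, rip y v = rip (Q u) v.
  apply: (@coercive_form_repr Q c (nm y)) => //.
  - by move=> u v; rewrite ripDr.
  - by move=> a u; rewrite ripZr.
  - exact: nm_ge0.
  - by move=> x; exact: norm_rip_le.
have [S hS] := choice repr.
have SK : cancel S Q by move=> y; apply: rip_ext => z; rewrite ripC -hS ripC.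
have injQ : injective Q.
  move=> x y xy; apply/eqP; rewrite -subr_eq0; apply/eqP/nm_eq0/eqP.
  rewrite -sqrf_eq0 eq_le sqr_ge0 andbT -(pmulr_rle0 _ c0) (le_trans (hc _))//.
  by rewrite linopB// xy subrr /rip linear0l.
have QK : cancel Q S by move=> x; apply: injQ; rewrite SK.
exists S; split=> //; apply: (@bounded_opI _ _ _ _ c^-1).
  by move=> a x y; apply: injQ; rewrite lQ !SK.
move=> y; rewrite ler_pdivlMl//.
have [->|S0] := eqVneq (S y) 0; first by rewrite nm0 mulr0 nm_ge0.
rewrite -(ler_pM2r (nm_gt0 S0)) -mulrA -expr2 (le_trans (hc _))// SK.
exact: rip_le.
Qed.

Lemma ripZ_scalar (t : R) x : rip (t%:C *: x) x = t * nm x ^+ 2.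
Proof. by rewrite ripZl ripxx. Qed.

Lemma symop_shift T (t : R) : symop T -> symop (fun x => T x + t%:C *: x).
Proof.
move=> sT x y; rewrite innerDl innerDr sT innerZl innerZr.
by rewrite (_ : conjc t%:C = t%:C) // conjc_real.
Qed.

(** For t < m the operator T - t is coercive, and for t > M so is t - T; either way T - t is
    invertible. *)
Lemma spectrum_bounds T (m M t : R) : bounded_op T -> symop T ->
  (forall x, m * nm x ^+ 2 <= rip (T x) x) ->
  (forall x, rip (T x) x <= M * nm x ^+ 2) ->
  spectrum T t%:C -> m <= t <= M.
Proof.
move=> bT sT hm hM tT; apply/andP; split; rewrite leNgt; apply/negP => lt; apply: tT.
- pose Q x := T x + (- t)%:C *: x.
  have bQ : bounded_op Q.
    by apply: bounded_op_add => //; apply: bounded_op_scale; exact: bounded_op_id.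
  have QE x : Q x = T x - t%:C *: x by rewrite /Q rmorphN scaleNr.
  have [||S [bS SK QK]] := @coercive_inverse Q (m - t) bQ (symop_shift _ sT).
  + by rewrite subr_gt0.
  + by move=> x; have := hm x; rewrite /Q ripDl ripZ_scalar; lra.
  by exists S; split => // x; rewrite -QE.
- pose Q x := - T x + t%:C *: x.
  have bN : bounded_op (fun x => - T x).
    by under eq_fun do rewrite -scaleN1r; exact: bounded_op_scale.
  have bQ : bounded_op Q.
    by apply: bounded_op_add => //; apply: bounded_op_scale; exact: bounded_op_id.
  have QE x : - Q x = T x - t%:C *: x by rewrite /Q opprD opprK.
  have sN : symop (fun x => - T x) by move=> x y; rewrite innerNl innerNr sT.
  have [||S [bS SK QK]] := @coercive_inverse Q (t - M) bQ (symop_shift _ sN).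
  + by rewrite subr_gt0.
  + by move=> x; have := hM x; rewrite /Q ripDl ripZ_scalar ripNl; lra.
  have lS := bounded_op_linear bS; have lQ := bounded_op_linear bQ.
  exists (fun x => - S x); split.
  + by under eq_fun do rewrite -scaleN1r; exact: bounded_op_scale.
  + by move=> x; rewrite -QE linopN// opprK.
  + by move=> x; rewrite -QE linopN// opprK.
Qed.

End LaxMilgram.

(** * Polynomials in a self-adjoint operator *)

Section PolynomialCalculus.
Context {R : realType} {H : hilbertType R}.
Implicit Types (x y z : H) (a t : R) (c : R[i]) (T S Q : H -> H) (p q : {poly R}) (P : {poly R[i]}).

(** Complex coefficients are there because the positivity proof splits a real polynomial into linear
    factors over [R[i]]. *)
Definition cpoly_op (P : {poly R[i]}) T x : H := \sum_(i < size P) P`_i *: iter i T x.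

Lemma cpoly_opE (P : {poly R[i]}) n T x : (size P <= n)%N ->
  cpoly_op P T x = \sum_(i < n) P`_i *: iter i T x.
Proof.
move=> Pn; rewrite /cpoly_op (big_ord_widen n (fun i => P`_i *: iter i T x))//.
rewrite big_mkcond; apply: eq_bigr => i _; case: ltnP => // Pi.
by rewrite nth_default// scale0r.
Qed.

Lemma cpoly_opD P (P2 : {poly R[i]}) T x : cpoly_op (P + P2) T x = cpoly_op P T x + cpoly_op P2 T x.
Proof.
pose n := maxn (size P) (size P2).
rewrite (@cpoly_opE _ n)// ?size_polyD// (@cpoly_opE P n) ?leq_maxl//.
rewrite (@cpoly_opE P2 n) ?leq_maxr// -big_split; apply: eq_bigr => i _.
by rewrite coefD scalerDl.
Qed.

Lemma cpoly_opZ c P T x : cpoly_op (c *: P) T x = c *: cpoly_op P T x.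
Proof.
rewrite (@cpoly_opE _ (size P)) ?size_scale_leq// scaler_sumr.
by apply: eq_bigr => i _; rewrite coefZ scalerA.
Qed.

Lemma cpoly_opC c T x : cpoly_op c%:P T x = c *: x.
Proof. by rewrite (@cpoly_opE _ 1) ?size_polyC_leq1// big_ord1 coefC. Qed.

Lemma cpoly_opMX P T x : cpoly_op (P * 'X) T x = cpoly_op P T (T x).
Proof.
have [->|P0] := eqVneq P 0; first by rewrite mul0r /cpoly_op !size_poly0 !big_ord0.
rewrite /cpoly_op size_mulX// big_ord_recl coefMX eqxx scale0r add0r.
by apply: eq_bigr => i _; rewrite coefMX /= -iterSr.
Qed.

(** With Y = T = S this is commutation of P(T) with T; with Y = X it carries polynomials in X^* X to
    polynomials in X X^*. *)
Lemma cpoly_op_intertwine P T S (Y : H -> H) x : linear Y ->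
  (forall x, Y (T x) = S (Y x)) -> Y (cpoly_op P T x) = cpoly_op P S (Y x).
Proof.
move=> lY YT; elim/poly_ind: P x => [|P c IH] x.
  by rewrite /cpoly_op size_poly0 !big_ord0 linop0.
by rewrite !cpoly_opD !cpoly_opC !cpoly_opMX linopD// linopZ// IH YT.
Qed.

Lemma cpoly_opM P (P2 : {poly R[i]}) T x : linear T ->
  cpoly_op (P * P2) T x = cpoly_op P T (cpoly_op P2 T x).
Proof.
move=> lT; elim/poly_ind: P x => [|P c IH] x.
  by rewrite mul0r /cpoly_op size_poly0 !big_ord0.
rewrite mulrDl mul_polyC mulrAC !cpoly_opD cpoly_opZ cpoly_opC !cpoly_opMX IH.
by rewrite (cpoly_op_intertwine _ _ lT (fun=> erefl)).
Qed.

Lemma cpoly_op_bounded P T : bounded_op T -> bounded_op (cpoly_op P T).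
Proof.
move=> bT; elim/poly_ind: P => [|P d IH].
  rewrite (_ : cpoly_op 0 T = fun x => 0 *: x).
    by apply: bounded_op_scale; exact: bounded_op_id.
  by apply/funext => x; rewrite /cpoly_op size_poly0 big_ord0 scale0r.
rewrite (_ : cpoly_op _ T = fun x => (cpoly_op P T \o T) x + d *: x).
  apply: bounded_op_add; first exact: bounded_op_comp.
  by apply: bounded_op_scale; exact: bounded_op_id.
by apply/funext => x; rewrite cpoly_opD cpoly_opC cpoly_opMX.
Qed.

Lemma poly_op_cpoly p T : poly_op p T = cpoly_op (map_poly (real_complex R) p) T.
Proof.
apply/funext => x; rewrite /poly_op /cpoly_op size_map_poly.
by apply: eq_bigr => i _; rewrite coef_map.
Qed.

Lemma poly_opD p q T x : poly_op (p + q) T x = poly_op p T x + poly_op q T x.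
Proof. by rewrite !poly_op_cpoly rmorphD cpoly_opD. Qed.

Lemma poly_opC a T x : poly_op a%:P T x = a%:C *: x.
Proof. by rewrite poly_op_cpoly map_polyC cpoly_opC. Qed.

Lemma poly_opM p q T x : linear T ->
  poly_op (p * q) T x = poly_op p T (poly_op q T x).
Proof. by move=> lT; rewrite !poly_op_cpoly rmorphM cpoly_opM. Qed.

Lemma poly_opN p T x : poly_op (- p) T x = - poly_op p T x.
Proof. by rewrite !poly_op_cpoly rmorphN -scaleN1r cpoly_opZ scaleN1r. Qed.

Lemma poly_opX T x : poly_op 'X T x = T x.
Proof. by rewrite poly_op_cpoly map_polyX -['X]mul1r cpoly_opMX cpoly_opC scale1r. Qed.

Lemma poly_opMX p T x : poly_op (p * 'X) T x = poly_op p T (T x).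
Proof. by rewrite !poly_op_cpoly rmorphM/= map_polyX cpoly_opMX. Qed.

Lemma poly_op_intertwine p T S (Y : H -> H) x : linear Y ->
  (forall x, Y (T x) = S (Y x)) -> Y (poly_op p T x) = poly_op p S (Y x).
Proof. by rewrite !poly_op_cpoly; exact: cpoly_op_intertwine. Qed.

Lemma poly_op_bounded p T : bounded_op T -> bounded_op (poly_op p T).
Proof. by rewrite poly_op_cpoly; exact: cpoly_op_bounded. Qed.

Lemma poly_op_symop p T : linear T -> symop T -> symop (poly_op p T).
Proof.
move=> lT sT; elim/poly_ind: p => [|p d IH] x y.
  by rewrite /poly_op size_poly0 !big_ord0 linear0l linear0r.
rewrite !poly_opD !poly_opC !poly_opMX innerDl innerDr innerZl innerZr IH sT.
rewrite (poly_op_intertwine _ _ lT (fun=> erefl)).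
by rewrite (_ : conjc d%:C = d%:C)// conjc_real.
Qed.

(** Weaker than invertibility, but stable under products and enough to contradict [quad_inf]. *)
Definition bounded_below T := exists2 k : R, 0 < k & forall x, k * nm x <= nm (T x).

Lemma Im_le_normc c : `|complex.Im c| <= Normc.normc c.
Proof.
case: c => u v /=; rewrite -sqrtr_sqr ler_sqrt ?lerDr ?sqr_ge0//.
by rewrite addr_ge0// sqr_ge0.
Qed.

(** Since <T x, x> is real, the imaginary part of <(T - c) x, x> is - Im c |x|^2. *)
Lemma bounded_below_nonreal T c : symop T -> complex.Im c != 0 ->
  bounded_below (fun x => T x - c *: x).
Proof.
move=> sT c0; exists `|complex.Im c|; first by rewrite normr_gt0.
move=> x; have [->|x0] := eqVneq x 0; first by rewrite nm0 mulr0 nm_ge0.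
rewrite -(ler_pM2r (nm_gt0 x0)) -mulrA -expr2.
apply: le_trans (normc_inner_le _ _); rewrite innerDl innerNl innerZl.
have -> : inner x x = (nm x ^+ 2)%:C by rewrite -sqr_norm_inner nmE rmorphXn.
apply: le_trans (Im_le_normc _).
have : inner (T x) x = conjc (inner (T x) x) by rewrite -innerC sT.
case: (inner (T x) x) => u v [] vN; case: c c0 => r s /= s0.
have -> : v - (r * 0 + s * nm x ^+ 2) = - (s * nm x ^+ 2) by move: vN; lra.
by rewrite normrN normrM (ger0_norm (sqr_ge0 _)).
Qed.

Lemma bounded_below_notin_spectrum T c : ~ spectrum T c ->
  bounded_below (fun x => T x - c *: x).
Proof.
move=> /contrapT[S [bS SK _]]; have [K K0 hK] := bounded_op_bound bS.
exists K^-1; first by rewrite invr_gt0.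
by move=> x; rewrite ler_pdivrMl// -{1}(SK x).
Qed.

Lemma bounded_below_prod T (s : seq R[i]) : linear T ->
  (forall c, c \in s -> bounded_below (fun x => T x - c *: x)) ->
  bounded_below (cpoly_op (\prod_(c <- s) ('X - c%:P)) T).
Proof.
move=> lT; elim: s => [|c s IH] hs.
  by rewrite big_nil; exists 1 => // x; rewrite mul1r -polyC1 cpoly_opC scale1r.
have [k k0 hk] := hs c (mem_head _ _).
have [|l l0 hl] := IH; first by move=> d ds; apply: hs; rewrite inE ds orbT.
exists (k * l); first by rewrite mulr_gt0.
move=> x; rewrite big_cons cpoly_opM//.
set y := cpoly_op _ T x.
rewrite -['X]mul1r -polyCN cpoly_opD cpoly_opMX -polyC1 !cpoly_opC scale1r scaleNr.
by rewrite -mulrA (le_trans _ (hk y))// ler_wpM2l// ltW.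
Qed.

(** The infimum l of the form on unit vectors is an approximate eigenvalue: a lower bound for |(Q -
    l) x| would improve l as a lower bound of the form. *)
Lemma quad_inf Q x0 : bounded_op Q -> symop Q -> x0 != 0 ->
  exists l, [/\ forall x, l * nm x ^+ 2 <= rip (Q x) x,
    l <= rip (Q x0) x0 / nm x0 ^+ 2 &
    ~ bounded_below (fun x => Q x - l%:C *: x)].
Proof.
move=> bQ sQ x00.
pose A : set R := [set l | forall x, l * nm x ^+ 2 <= rip (Q x) x].
have n0 : 0 < nm x0 ^+ 2 by rewrite exprn_gt0// nm_gt0.
have [K K0 hK] := bounded_op_bound bQ.
have ubA : ubound A (rip (Q x0) x0 / nm x0 ^+ 2).
  by move=> l /(_ x0) hl; rewrite ler_pdivlMr.
have hA : has_sup A.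
  split; last by exists (rip (Q x0) x0 / nm x0 ^+ 2).
  exists (- K) => x; have := norm_rip_le (Q x) x; rewrite ler_norml => /andP[+ _].
  apply: le_trans; rewrite mulNr lerN2 expr2 mulrA.
  by rewrite ler_wpM2r ?nm_ge0.
pose l := sup A.
(* [A] contains its supremum. The 1 added in the denominator covers x = 0. *)
have Al : A l.
  move=> x; apply/ler_addgt0Pr => e e0.
  have d0 : 0 < e / (nm x ^+ 2 + 1) by rewrite divr_gt0// ltr_wpDl ?sqr_ge0.
  have [m Am lm] := sup_adherent d0 hA.
  rewrite -lerBlDr (le_trans _ (Am x))// lerBlDr -lerBlDl -mulrBl.
  have h : l - m <= e / (nm x ^+ 2 + 1) by rewrite lerBlDl -lerBlDr ltW.
  rewrite (le_trans (ler_wpM2r (sqr_ge0 _) h))// mulrAC ler_pdivrMr ?ltr_wpDl ?sqr_ge0//.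
  by rewrite ler_wpM2l ?(ltW e0)// lerDl.
exists l; split => //; first by apply: ge_sup => //; case: hA.
move=> [k k0 hk].
pose Q' x := Q x + (- l)%:C *: x.
have bQ' : bounded_op Q'.
  by apply: bounded_op_add => //; apply: bounded_op_scale; exact: bounded_op_id.
have sQ' : symop Q' by exact: symop_shift.
have pQ' : posop Q'.
  by move=> x; rewrite /Q' ripDl ripZ_scalar mulNr subr_ge0; exact: Al.
have lQ' := bounded_op_linear bQ'.
have [L L0 hL] := bounded_op_bound bQ'.
(* Cauchy-Schwarz for the positive form of [Q'], applied to x and Q' x. With a lower bound k for
   [Q'] it lets l grow to l + k^2 / L. *)
have key x : nm (Q' x) ^+ 2 <= L * rip (Q' x) x.
  have [->|y0] := eqVneq (Q' x) 0.
    by rewrite nm0 expr0n/= /rip linear0l mulr0.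
  have y2 : 0 < nm (Q' x) ^+ 2 by rewrite exprn_gt0// nm_gt0.
  have CS : (nm (Q' x) ^+ 2) ^+ 2 <= rip (Q' x) x * rip (Q' (Q' x)) (Q' x).
    by rewrite -ripxx; exact: posop_cauchy_schwarz.
  have h : rip (Q' (Q' x)) (Q' x) <= L * nm (Q' x) ^+ 2.
    by rewrite (le_trans (rip_le _ _))// expr2 mulrA ler_wpM2r ?nm_ge0.
  rewrite -(ler_pM2r y2) -expr2 (le_trans CS)// -mulrA mulrCA.
  by rewrite ler_wpM2l.
have : A (l + k ^+ 2 / L).
  move=> x; rewrite mulrDl -lerBrDl.
  have -> : rip (Q x) x - l * nm x ^+ 2 = rip (Q' x) x.
    by rewrite /Q' ripDl ripZ_scalar mulNr.
  rewrite mulrAC ler_pdivrMr// [leRHS]mulrC (le_trans _ (key x))// -exprMn.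
  rewrite ler_pXn2r ?nnegrE ?nm_ge0 ?mulr_ge0 ?nm_ge0 ?(ltW k0)//.
  by rewrite /Q' rmorphN scaleNr; exact: hk.
move=> /(ub_le_sup (proj2 hA)); rewrite -/l gerDl leNgt divr_gt0//.
by rewrite exprn_gt0.
Qed.

(** Excludes p = l < 0 as a constant in [poly_op_ge0], where the sign hypothesis would be vacuous on
    an empty spectrum. *)
Lemma spectrum_nonempty T x0 : bounded_op T -> symop T -> x0 != 0 ->
  exists t : R, spectrum T t%:C.
Proof.
move=> bT sT x00; have [l [_ _ hl]] := quad_inf bT sT x00.
by exists l; apply: contrapT => /bounded_below_notin_spectrum.
Qed.

Lemma poly_op_ge0 T p : bounded_op T -> symop T ->
  (forall t, spectrum T t%:C -> 0 <= p.[t]) -> posop (poly_op p T).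
Proof.
move=> bT sT hp x0; have lT := bounded_op_linear bT.
have [->|x00] := eqVneq x0 0.
  by rewrite /rip linear0r.
have [l [_ hl nb]] := quad_inf (poly_op_bounded p bT) (poly_op_symop p lT sT) x00.
rewrite leNgt; apply/negP => lt0; have {}hl : l < 0.
  by rewrite (le_lt_trans hl)// pmulr_llt0// invr_gt0 exprn_gt0// nm_gt0.
apply: nb; pose P := p - l%:P; pose cP := map_poly (real_complex R) P.
have P0 : P != 0.
  apply/eqP => P0; have [t tT] := spectrum_nonempty bT sT x00.
  have := hp t tT; have /(congr1 (fun q => q.[t])) := P0.
  by rewrite !hornerE => /eqP; rewrite subr_eq0 => /eqP ->; rewrite leNgt hl.
have cP0 : lead_coef cP != 0 by rewrite lead_coef_eq0 map_poly_eq0.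
have [s Es] := closed_field_poly_normal cP.
have [k k0 hk] : bounded_below (cpoly_op (\prod_(c <- s) ('X - c%:P)) T).
  apply: bounded_below_prod => // c cs.
  have rc : root cP c by rewrite Es rootZ// root_prod_XsubC.
  (* Nonreal roots are harmless because T is symmetric; at a real root p takes the value l < 0, so
     the root lies off the spectrum. *)
  have [c_real|] := eqVneq (complex.Im c) 0; last exact: bounded_below_nonreal.
  have cE : c = (complex.Re c)%:C by case: c c_real {cs rc} => u v /= ->.
  apply: bounded_below_notin_spectrum; rewrite cE => /hp.
  move: rc; rewrite cE /cP fmorph_root /root /P !hornerE subr_eq0 => /eqP ->.
  by rewrite leNgt hl.
exists (Normc.normc (lead_coef cP) * k).
  rewrite mulr_gt0// lt_def normc_ge0 andbT.
  by apply/eqP => /Normc.eq0_normc/eqP; rewrite (negPf cP0).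
move=> x; rewrite -scaleNr -rmorphN -(poly_opC _ T) -poly_opD polyCN -/P.
by rewrite poly_op_cpoly -/cP [X in cpoly_op X _ _]Es cpoly_opZ nmZ -mulrA ler_wpM2l ?normc_ge0.
Qed.

End PolynomialCalculus.

(** * Uniform polynomial approximation *)

Section Weierstrass.
Context {R : realType}.
Implicit Types (x y t e K M : R) (f h g : nat -> R) (n : nat).

(* The Bernstein polynomial of the nodes [h 0, ..., h n]. The recursion conditions
   on the first of n coin tosses, so that no binomial sum is needed. *)
Fixpoint bernstein n h : {poly R} :=
  if n is n'.+1 then 'X * bernstein n' (h \o succn) + (1 - 'X) * bernstein n' h
  else (h 0)%:P.

Lemma bernsteinS n h x :
  (bernstein n.+1 h).[x] = x * (bernstein n (h \o succn)).[x] + (1 - x) * (bernstein n h).[x].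
Proof. by rewrite /= !hornerE. Qed.

Lemma bernstein_affine n g (a b : R) x :
  (bernstein n (fun k => a + b * g k)).[x] = a + b * (bernstein n g).[x].
Proof.
elim: n g => [|n IH] g; first by rewrite /= !hornerE.
rewrite !bernsteinS IH (_ : _ \o _ = fun k => a + b * (g \o succn) k)// IH; ring.
Qed.

Lemma bernstein_le n h g x : 0 <= x <= 1 -> (forall k, (k <= n)%N -> h k <= g k) ->
  (bernstein n h).[x] <= (bernstein n g).[x].
Proof.
move=> /andP[x0 x1]; elim: n h g => [|n IH] h g hg; first by rewrite !hornerE hg.
rewrite !bernsteinS lerD// ler_wpM2l ?subr_ge0// IH// => k kn; apply: hg => //.
exact: ltnW.
Qed.

(** Second moment about c of the number of heads in n tosses. A general centre is needed for
    induction: a first head moves c to c - 1. *)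
Lemma bernstein_variance n c x :
  (bernstein n (fun k => (k%:R - c) ^+ 2)).[x] = (n%:R * x - c) ^+ 2 + n%:R * (x * (1 - x)).
Proof.
elim: n c => [|n IH] c; first by rewrite /= !hornerE; ring.
rewrite bernsteinS (_ : _ \o _ = fun k : nat => (k%:R - (c - 1)) ^+ 2); last first.
  by apply/funext => k /=; rewrite -natr1; ring.
by rewrite !IH -natr1; ring.
Qed.

(** For fixed x, f lies between the parabolas f x -/+ (e / 2 + K (y - x)^2). Bernstein operators are
    monotone, and the variance turns the quadratic term into K x (1 - x) / n. *)
Lemma weierstrass_unit (f : R -> R) :
  (forall e, 0 < e -> exists2 K, 0 <= K & forall x y, 0 <= x <= 1 -> 0 <= y <= 1 ->
     `|f x - f y| <= e + K * (x - y) ^+ 2) ->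
  forall e, 0 < e -> exists p : {poly R}, forall x, 0 <= x <= 1 -> `|p.[x] - f x| <= e.
Proof.
move=> hf e e0; have e20 : 0 < e / 2 by rewrite divr_gt0.
have [K K0 hK] := hf _ e20.
(* Chosen so that 1/n <= d makes the variance term at most e / 2; K + 1 avoids dividing by zero. *)
have d0 : 0 < e / 2 / (K + 1) by rewrite divr_gt0// ltr_wpDl.
have [N /(_ N (leqnn N)) hN] := invS_small d0.
pose n := N.+1; have n0 : 0 < n%:R :> R by rewrite ltr0n.
exists (bernstein n (fun k => f (k%:R / n%:R))) => x x01; have /andP[x0 x1] := x01.
have kn k : (k <= n)%N -> 0 <= (k%:R / n%:R : R) <= 1.
  by move=> kn; rewrite divr_ge0//= ler_pdivrMr// mul1r ler_nat.
have quad k : K * (k%:R / n%:R - x) ^+ 2 = K / n%:R ^+ 2 * (k%:R - n%:R * x) ^+ 2.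
  by field; rewrite gt_eqF.
have var : K / n%:R ^+ 2 * (n%:R * (x * (1 - x))) <= e / 2.
  have -> : K / n%:R ^+ 2 * (n%:R * (x * (1 - x))) = K * (x * (1 - x)) * n%:R^-1.
    by field; rewrite gt_eqF.
  have h1 : K * (x * (1 - x)) <= K + 1.
    have : x * (1 - x) <= 1 by nra.
    move=> /(ler_wpM2l K0); lra.
  have : n%:R^-1 * (K + 1) <= e / 2 by rewrite -ler_pdivlMr// ltr_wpDl.
  by apply: le_trans; rewrite mulrC ler_wpM2l// invr_ge0 ltW.
rewrite ler_distl; apply/andP; split.
- have := @bernstein_le n
    (fun k => (f x - e / 2) + - (K / n%:R ^+ 2) * (k%:R - n%:R * x) ^+ 2)
    (fun k => f (k%:R / n%:R)) x x01.
  rewrite bernstein_affine bernstein_variance subrr expr0n add0r mulNr => h.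
  apply: le_trans (h _); first by move: var; lra.
  move=> k /kn /hK /(_ x01); rewrite quad ler_distl => /andP[+ _]; lra.
- have := @bernstein_le n (fun k => f (k%:R / n%:R))
    (fun k => (f x + e / 2) + (K / n%:R ^+ 2) * (k%:R - n%:R * x) ^+ 2) x x01.
  rewrite bernstein_affine bernstein_variance subrr expr0n add0r => h.
  apply: le_trans (h _) _; last by move: var; lra.
  move=> k /kn /hK /(_ x01); rewrite quad ler_distl => /andP[_ +]; lra.
Qed.

(* On a segment this amounts to continuity; it is the form which the variance of
   the Bernstein polynomials controls. *)
Definition quad_continuous M (f : R -> R) :=
  forall e, 0 < e -> exists2 K, 0 <= K & forall x y, 0 <= x <= M -> 0 <= y <= M ->
     `|f x - f y| <= e + K * (x - y) ^+ 2.

Lemma weierstrass M (f : R -> R) : 0 < M -> quad_continuous M f ->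
  forall e, 0 < e -> exists p : {poly R}, forall x, 0 <= x <= M -> `|p.[x] - f x| <= e.
Proof.
move=> M0 hf e e0.
have [|p hp] := @weierstrass_unit (fun t => f (M * t)) _ e e0.
  move=> d d0; have [K K0 hK] := hf d d0; exists (K * M ^+ 2).
    by rewrite mulr_ge0// sqr_ge0.
  have mem t : 0 <= t <= 1 -> 0 <= M * t <= M.
    by move=> /andP[t0 t1]; rewrite mulr_ge0 ?(ltW M0)//= ger_pMr.
  move=> x y x01 y01; have := hK _ _ (mem x x01) (mem y y01).
  by rewrite -mulrBr exprMn mulrA.
exists (p \Po (M^-1 *: 'X)) => x /andP[x0 xM].
have := hp (x / M); rewrite divr_ge0 ?(ltW M0)//= ler_pdivrMr// mul1r xM => /(_ isT).
by rewrite mulrCA mulfV ?gt_eqF// mulr1 horner_comp !hornerE mulrC.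
Qed.

(** Around each point, nearby pairs are handled by continuity, and distant pairs by taking K so
    large that the quadratic term exceeds 2 B. Compactness makes K uniform. *)
Lemma compact_quad_continuous M B (f : R -> R) :
  (forall x, 0 <= x <= M -> `|f x| <= B) ->
  (forall x e, 0 <= x <= M -> 0 < e -> exists2 d, 0 < d & forall y, 0 <= y <= M ->
     `|y - x| < d -> `|f y - f x| <= e) ->
  quad_continuous M f.
Proof.
move=> hB hf e e0.
pose P K x := 0 <= x <= M ->
  forall y, 0 <= y <= M -> `|f x - f y| <= e + K * (x - y) ^+ 2.
suff : \forall K \near +oo, `[0, M] `<=` P K.
  move=> /pinfty_ex_gt0[K K0 hK]; exists K; first exact: ltW.
  by move=> x y x01; apply: hK.
apply: (compact_near_coveringP _).1; first exact: segment_compact.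
move=> x0 /=; rewrite in_itv/= => x0M.
have e20 : 0 < e / 2 by rewrite divr_gt0.
have [d d0 hd] := hf x0 _ x0M e20.
have d20 : 0 < d / 2 by rewrite divr_gt0.
near=> x K => xM y yM.
have K0 : 0 <= K by near: K; exact: nbhs_pinfty_ge.
have xx0 : `|x - x0| < d / 2 by rewrite distrC; near: x; apply/nbhs_ballP; exists (d / 2).
have xd : `|x - x0| < d by move: xx0 d0; lra.
have hx := hd _ xM xd.
have [yx0|yx0] := ltP `|y - x0| d.
  have hy := hd _ yM yx0; apply: (@le_trans _ _ e); last first.
    by rewrite lerDl mulr_ge0// sqr_ge0.
  by move: hx hy; rewrite !ler_distl => /andP[? ?] /andP[? ?]; apply/andP; split; lra.
have xy : d / 2 <= `|x - y|.
  have : `|y - x0| <= `|x - y| + `|x - x0| by rewrite (distrC x y) ler_distD.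
  move: xx0 yx0; lra.
apply: (@le_trans _ _ (K * (d / 2) ^+ 2)).
  rewrite -ler_pdivrMr ?exprn_gt0//; apply: (@le_trans _ _ ((B + B) / (d / 2) ^+ 2)).
    rewrite ler_wpM2r ?invr_ge0 ?sqr_ge0// (le_trans (ler_normB _ _))//.
    by rewrite lerD// hB.
  by near: K; apply: nbhs_pinfty_ge; exact: num_real.
rewrite (@le_trans _ _ (K * (x - y) ^+ 2))//; last by rewrite lerDr ltW.
by rewrite ler_wpM2l// -(real_normK (num_real (x - y))) ler_pXn2r ?nnegrE// ltW.
Unshelve. all: by end_near. Qed.

Lemma powR_quad_continuous M (a : R) : 0 <= a -> quad_continuous M (fun t => t `^ a).
Proof.
rewrite le_eqVlt => /orP[/eqP <-|a0].
  by move=> e e0; exists 0 => // x y _ _; rewrite !powRr0 subrr normr0 mul0r addr0 ltW.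
apply: (@compact_quad_continuous _ (M `^ a)).
  move=> x /andP[x0 xM]; rewrite ger0_norm ?powR_ge0//.
  by rewrite ge0_ler_powR ?nnegrE ?(ltW a0)// (le_trans x0).
move=> x e /andP[]; rewrite le_eqVlt => /orP[/eqP <- _|x0 _] e0.
  (* The power may fail to be differentiable at 0, so the radius there is found by solving d^a = e;
     elsewhere continuity comes from differentiability. *)
  exists (e `^ a^-1); first exact: powR_gt0.
  move=> y /andP[y0 _]; rewrite subr0 ger0_norm// powR0 ?gt_eqF// subr0.
  rewrite ger0_norm ?powR_ge0// => ye.
  rewrite -[leRHS](powRr1 (ltW e0)) -(@mulVf _ a) ?gt_eqF// powRrM.
  by rewrite ge0_ler_powR ?nnegrE ?powR_ge0// ltW.
have : {for x, continuous (fun t : R => t `^ a)}.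
  apply: differentiable_continuous; apply/derivable1_diffP.
  by apply: derivable_powR; rewrite in_itv/= x0.
move=> /cvgrPdist_le/(_ _ e0)/nbhs_ballP[d /= d0 hd]; exists d => // y _ yd.
by rewrite distrC; apply: hd; rewrite /ball/= distrC.
Qed.

(** As f >= 0, denominators stay above d, so taking the reciprocal costs a factor 1 / d^2. *)
Lemma quad_continuous_inv M (f : R -> R) d : 0 < d ->
  (forall x, 0 <= x <= M -> 0 <= f x) -> quad_continuous M f ->
  quad_continuous M (fun t => (f t + d)^-1).
Proof.
move=> d0 f0 hf e e0.
have [|K K0 hK] := hf (e * d ^+ 2); first by rewrite mulr_gt0// exprn_gt0.
exists (K / d ^+ 2); first by rewrite divr_ge0// sqr_ge0.
move=> x y xM yM; have fx := f0 _ xM; have fy := f0 _ yM.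
have px : 0 < f x + d by rewrite ltr_wpDl.
have py : 0 < f y + d by rewrite ltr_wpDl.
have -> : (f x + d)^-1 - (f y + d)^-1 = (f y - f x) / ((f x + d) * (f y + d)).
  by field; rewrite !gt_eqF.
have -> : e + K / d ^+ 2 * (x - y) ^+ 2 = (e * d ^+ 2 + K * (x - y) ^+ 2) / d ^+ 2.
  by field; rewrite gt_eqF.
have p2 : d ^+ 2 <= (f x + d) * (f y + d) by rewrite expr2 ler_pM ?(ltW d0)// lerDr.
rewrite normrM normrV ?unitfE ?mulf_neq0 ?gt_eqF// (gtr0_norm (mulr_gt0 px py)) distrC.
apply: ler_pM => //; first by rewrite invr_ge0 ltW// mulr_gt0.
  exact: hK.
by rewrite lef_pV2 ?posrE ?exprn_gt0 ?mulr_gt0.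
Qed.

End Weierstrass.

(** * Continuous functional calculus *)

Section FunctionalCalculus.
Context {R : realType} {H : hilbertType R}.
Implicit Types (x y z : H) (a t d e : R) (c : R[i]) (T S Q : H -> H) (p q : {poly R}).
Implicit Types (f g : R -> R).

Lemma le0_small (r K : R) : 0 <= K -> (forall e, 0 < e -> r <= e * K) -> r <= 0.
Proof.
move=> K0 h; apply/ler_addgt0Pr => e e0; rewrite add0r.
have d0 : 0 < e / (K + 1) by rewrite divr_gt0// ltr_wpDl.
rewrite (le_trans (h _ d0))// mulrAC ler_pdivrMr ?ltr_wpDl//.
by rewrite ler_wpM2l ?(ltW e0)// lerDl.
Qed.

(* Same relation as in [cfc], with the sequence of polynomials replaced by one
   polynomial for each precision. *)
Definition is_cfc f T S := bounded_op S /\ forall e, 0 < e -> exists p,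
  (forall t, spectrum T t%:C -> `|p.[t] - f t| <= e) /\
  (forall x, nm (poly_op p T x - S x) <= e * nm x).

Definition positive_op T := [/\ bounded_op T, symop T & posop T].

Lemma nm_triangle x y z : nm (x - z) <= nm (x - y) + nm (y - z).
Proof. by rewrite -{1}[x](subrK y) -addrA nmD. Qed.

Lemma nm_le_sub x y : nm x <= nm y + nm (y - x).
Proof. by rewrite -{1}[x](subKr y) (le_trans (nmD _ _))// nmN. Qed.

Section FixedOperator.
Variable T : H -> H.
Hypotheses (bT : bounded_op T) (sT : symop T).
Let lT := bounded_op_linear bT.

(** The squared inequality is positivity of (d^2 - p^2)(T), since p(T) is symmetric. *)
Lemma poly_op_le p d x : 0 <= d ->
  (forall t, spectrum T t%:C -> `|p.[t]| <= d) -> nm (poly_op p T x) <= d * nm x.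
Proof.
move=> d0 hp.
have : posop (poly_op ((d ^+ 2)%:P - p * p) T).
  apply: poly_op_ge0 => // t /hp h; rewrite !hornerE subr_ge0 -expr2.
  by rewrite -(real_normK (num_real p.[t])) ler_pXn2r ?nnegrE.
move=> /(_ x); rewrite poly_opD poly_opC poly_opN poly_opM// ripDl ripNl ripZ_scalar.
rewrite (symop_rip _ _ (poly_op_symop p lT sT)) ripxx subr_ge0 -exprMn.
by rewrite ler_pXn2r ?nnegrE ?mulr_ge0 ?nm_ge0.
Qed.

Lemma is_cfc_le f S d x : is_cfc f T S -> 0 <= d ->
  (forall t, spectrum T t%:C -> `|f t| <= d) -> nm (S x) <= d * nm x.
Proof.
move=> [bS hS] d0 hf; rewrite -subr_le0.
apply: (@le0_small _ (2 * nm x)); first by rewrite mulr_ge0 ?nm_ge0.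
move=> e e0; have [p [hp hpS]] := hS e e0.
have := @poly_op_le p (d + e) x; rewrite addr_ge0 ?(ltW e0)// => /(_ isT) h.
have {}h : nm (poly_op p T x) <= (d + e) * nm x.
  apply: h => t tT; rewrite -(subrK (f t) p.[t]) (le_trans (ler_normD _ _))// addrC.
  by rewrite lerD ?hf ?hp.
have := nm_le_sub (S x) (poly_op p T x); have := hpS x; move: h; lra.
Qed.

Lemma is_cfc_ge0 f S : is_cfc f T S ->
  (forall t, spectrum T t%:C -> 0 <= f t) -> posop S.
Proof.
move=> [bS hS] hf x; rewrite -oppr_le0.
apply: (@le0_small _ (2 * nm x ^+ 2)); first by rewrite mulr_ge0 ?sqr_ge0.
move=> e e0; have [p [hp hpS]] := hS e e0.
(* p is only within e of f >= 0, so it is shifted by e to be nonnegative on the spectrum. *)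
have : posop (poly_op (p + e%:P) T).
  apply: poly_op_ge0 => // t tT; rewrite !hornerE.
  by have := hp t tT; have := hf t tT; rewrite ler_distl => ? /andP[]; lra.
move=> /(_ x); rewrite poly_opD poly_opC ripDl ripZ_scalar.
have : rip (poly_op p T x - S x) x <= e * nm x ^+ 2.
  by rewrite (le_trans (rip_le _ _))// expr2 mulrA ler_wpM2r ?nm_ge0.
rewrite ripDl ripNl; lra.
Qed.

Lemma is_cfc_ext f g S : is_cfc f T S ->
  (forall t, spectrum T t%:C -> f t = g t) -> is_cfc g T S.
Proof.
move=> [bS hS] fg; split=> // e e0; have [p [hp hpS]] := hS e e0.
by exists p; split=> // t tT; rewrite -fg// hp.
Qed.

Lemma is_cfc_poly p : is_cfc (horner p) T (poly_op p T).
Proof.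
split; first exact: poly_op_bounded.
move=> e e0; exists p; split; first by move=> t _; rewrite subrr normr0 ltW.
by move=> x; rewrite subrr nm0 mulr_ge0 ?nm_ge0// ltW.
Qed.

Lemma is_cfcD f g S Q : is_cfc f T S -> is_cfc g T Q ->
  is_cfc (fun t => f t + g t) T (fun x => S x + Q x).
Proof.
move=> [bS hS] [bQ hQ]; split; first exact: bounded_op_add.
move=> e e0; have e20 : 0 < e / 2 by rewrite divr_gt0.
have [p [hp hpS]] := hS _ e20; have [q [hq hqQ]] := hQ _ e20.
exists (p + q); split.
  move=> t tT; rewrite hornerD opprD addrACA (le_trans (ler_normD _ _))//.
  by have := hp t tT; have := hq t tT; lra.
move=> x; rewrite poly_opD opprD addrACA (le_trans (nmD _ _))//.
by have := hpS x; have := hqQ x; lra.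
Qed.

Lemma is_cfcN f S : is_cfc f T S -> is_cfc (fun t => - f t) T (fun x => - S x).
Proof.
move=> [bS hS]; split.
  by under eq_fun do rewrite -scaleN1r; exact: bounded_op_scale.
move=> e e0; have [p [hp hpS]] := hS _ e0; exists (- p); split.
  by move=> t tT; rewrite hornerN -opprD normrN hp.
by move=> x; rewrite poly_opN -opprD nmN.
Qed.

Lemma is_cfcM f g S Q (Bf Bg : R) :
  (forall t, spectrum T t%:C -> `|f t| <= Bf) ->
  (forall t, spectrum T t%:C -> `|g t| <= Bg) ->
  is_cfc f T S -> is_cfc g T Q -> is_cfc (fun t => f t * g t) T (S \o Q).
Proof.
move=> hf hg [bS hS] [bQ hQ]; split; first exact: bounded_op_comp.
have [K K0 hK] := bounded_op_bound bS; have [L L0 hL] := bounded_op_bound bQ.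
move=> e e0.
(* [B] dominates every bound in sight. With d <= 1, the two errors of a telescoped product total d
   (d + B) + B d <= d (2 B + 1) <= e. *)
pose B := `|Bf| + `|Bg| + K + L + 1.
have B1 : 1 <= B by rewrite lerDr !addr_ge0// ltW.
have B0 : 0 < B by rewrite (lt_le_trans ltr01).
have BB : 0 < B + B + 1 by apply: addr_gt0 => //; apply: addr_gt0.
pose d := Num.min 1 (e / (B + B + 1)).
have d0 : 0 < d by rewrite lt_min ltr01 divr_gt0.
have d1 : d <= 1 by rewrite ge_min lexx.
have dB : d * (B + B + 1) <= e.
  by rewrite -ler_pdivlMr// ge_min lexx orbT.
have dB' : d * (d + B) + B * d <= e.
  apply: le_trans dB; rewrite (mulrC B) -mulrDr ler_wpM2l ?(ltW d0)//; lra.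
have [p [hp hpS]] := hS _ d0; have [q [hq hqQ]] := hQ _ d0.
have := normr_ge0 Bf; have := normr_ge0 Bg => Bg0 Bf0.
exists (p * q); split.
  move=> t tT; rewrite hornerM.
  have -> : p.[t] * q.[t] - f t * g t = (p.[t] - f t) * q.[t] + f t * (q.[t] - g t).
    by ring.
  rewrite (le_trans (ler_normD _ _))// !normrM (le_trans _ dB')//.
  rewrite lerD// ler_pM ?hp ?hq//.
    have -> : q.[t] = (q.[t] - g t) + g t by ring.
    rewrite (le_trans (ler_normD _ _))// lerD ?hq// (le_trans (hg t tT))//.
    by rewrite (le_trans (ler_norm _))// /B; lra.
  by rewrite (le_trans (hf t tT))// (le_trans (ler_norm _))// /B; lra.
move=> x; rewrite poly_opM//=; set y := poly_op q T x.
rewrite (le_trans (nm_triangle _ (S y) _))//.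
have h1 := hpS y; have h2 := hK (y - Q x).
rewrite linopB in h2; last exact: bounded_op_linear.
have h3 : nm y <= (d + B) * nm x.
  rewrite -(subrK (Q x) y) (le_trans (nmD _ _))// mulrDl lerD//.
    exact: hqQ.
  by rewrite (le_trans (hL x))// ler_wpM2r ?nm_ge0// /B; lra.
apply: (@le_trans _ _ ((d * (d + B) + B * d) * nm x)); last by rewrite ler_wpM2r ?nm_ge0.
rewrite mulrDl lerD//.
  by rewrite (le_trans h1)// -mulrA ler_wpM2l// ltW.
rewrite (le_trans h2)// -mulrA ler_pM ?nm_ge0 ?(ltW K0)//; last exact: hqQ.
by rewrite /B; lra.
Qed.

Lemma is_cfc_sym f S : is_cfc f T S -> symop S.
Proof.
move=> [bS hS] x y; apply/eqP; rewrite -subr_eq0; apply/eqP/Normc.eq0_normc/eqP.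
rewrite eq_le normc_ge0 andbT; apply: (@le0_small _ (2 * (nm x * nm y))).
  by rewrite !mulr_ge0 ?nm_ge0.
move=> e e0; have [p [_ hpS]] := hS _ e0.
have -> : inner (S x) y - inner x (S y) =
    inner x (poly_op p T y - S y) - inner (poly_op p T x - S x) y.
  by rewrite innerDl innerDr innerNl innerNr (poly_op_symop p lT sT); ring.
rewrite (le_trans (le_normcD _ _))// normcN.
have h1 := normc_inner_le x (poly_op p T y - S y).
have h2 := normc_inner_le (poly_op p T x - S x) y.
have h3 := ler_wpM2l (nm_ge0 x) (hpS y).
have h4 := ler_wpM2r (nm_ge0 y) (hpS x); move: h1 h2 h3 h4; lra.
Qed.

(** S - Q represents the zero function, so [is_cfc_le] bounds it by 0. *)
Lemma is_cfc_uniq f S Q : is_cfc f T S -> is_cfc f T Q -> S = Q.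
Proof.
move=> hS hQ; apply/funext => x; apply/eqP; rewrite -subr_eq0; apply/eqP/nm_eq0/eqP.
rewrite eq_le nm_ge0 andbT -[leRHS](mul0r (nm x)).
apply: (is_cfc_le _ (is_cfcD hS (is_cfcN hQ))) => // t _.
by rewrite subrr normr0.
Qed.

Variable M : R.
Hypotheses (M0 : 0 < M) (hM : forall t, spectrum T t%:C -> 0 <= t <= M).

(** Polynomials close to f on [0, M] are close to each other on the spectrum, so [poly_op_le] makes
    their values at T Cauchy in operator norm. *)
Lemma is_cfc_exists f : quad_continuous M f -> exists S, is_cfc f T S.
Proof.
move=> hf.
have /choice[p hp] (n : nat) : exists p : {poly R},
    forall t, 0 <= t <= M -> `|p.[t] - f t| <= n.+1%:R^-1.
  by apply: weierstrass => //; rewrite invr_gt0.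
have n0 n : 0 <= n.+1%:R^-1 :> R by rewrite invr_ge0.
have cau m n x : nm (poly_op (p m) T x - poly_op (p n) T x) <=
    (m.+1%:R^-1 + n.+1%:R^-1) * nm x.
  rewrite -poly_opN -poly_opD; apply: poly_op_le; first by rewrite addr_ge0.
  move=> t /hM tM; have := hp m t tM; have := hp n t tM; rewrite hornerD hornerN.
  move: (m.+1%:R^-1) (n.+1%:R^-1) => a b; rewrite !ler_norml.
  by move=> /andP[? ?] /andP[? ?]; apply/andP; split; lra.
have /choice[S hS] x : exists l, forall e, 0 < e ->
    exists N, forall n, (N <= n)%N -> nm (poly_op (p n) T x - l) <= e.
  apply: cauchy_lim => e e0.
  have d0 : 0 < e / (2 * (nm x + 1)) by rewrite divr_gt0// mulr_gt0// ltr_wpDl ?nm_ge0.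
  have [N hN] := invS_small d0; exists N => m n Nm Nn.
  rewrite (le_trans (cau m n x))//.
  apply: (@le_trans _ _ ((e / (2 * (nm x + 1)) + e / (2 * (nm x + 1))) * nm x)).
    by rewrite ler_wpM2r ?nm_ge0// lerD ?hN.
  have -> : (e / (2 * (nm x + 1)) + e / (2 * (nm x + 1))) * nm x = e * (nm x / (nm x + 1)).
    by field; rewrite gt_eqF// ltr_wpDl ?nm_ge0.
  by rewrite ger_pMr// ler_pdivrMr ?mul1r ?lerDl// ltr_wpDl ?nm_ge0.
(* Letting the other index of [cau] tend to infinity turns pointwise convergence into a rate uniform
   on the unit ball. *)
have lim n x : nm (poly_op (p n) T x - S x) <= n.+1%:R^-1 * nm x.
  apply/ler_addgt0Pr => e e0; have e20 : 0 < e / 2 by rewrite divr_gt0.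
  have d0 : 0 < e / 2 / (nm x + 1) by rewrite divr_gt0// ltr_wpDl ?nm_ge0.
  have [N1 hN1] := invS_small d0; have [N2 hN2] := hS x _ e20.
  pose k := maxn N1 N2; have {hN1}h1 := hN1 k (leq_maxl _ _).
  have {hN2}h2 := hN2 k (leq_maxr _ _).
  have h3 : k.+1%:R^-1 * nm x <= e / 2.
    rewrite (le_trans (ler_wpM2r (nm_ge0 x) h1))// mulrAC ler_pdivrMr ?ltr_wpDl ?nm_ge0//.
    by rewrite ler_wpM2l ?(ltW e20)// lerDl.
  rewrite (le_trans (nm_triangle _ (poly_op (p k) T x) _))//.
  have h4 := cau n k x; rewrite mulrDl in h4.
  move: h2 h3 h4; move: (k.+1%:R^-1 * nm x) (n.+1%:R^-1 * nm x) => u v; lra.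
have nsmall d : 0 < d -> exists n, n.+1%:R^-1 <= d.
  by move=> d0; have [N hN] := invS_small d0; exists N; apply: hN.
exists S; split; last first.
  move=> e e0; have [n hn] := nsmall e e0; exists (p n); split.
    by move=> t /hM tM; rewrite (le_trans (hp n t tM)).
  by move=> x; rewrite (le_trans (lim n x))// ler_wpM2r ?nm_ge0.
(* At index 0 the tolerance is 1, whence the bound K + 1 for [S]. *)
have [K K0 hK] := bounded_op_bound (poly_op_bounded (p 0) bT).
apply: (@bounded_opI _ _ _ _ (K + 1)); last first.
  move=> x; rewrite (le_trans (nm_le_sub _ (poly_op (p 0) T x)))// mulrDl lerD//.
  by have := lim 0%N x; rewrite invr1.
move=> c x y; apply/eqP; rewrite -subr_eq0; apply/eqP/nm_eq0/eqP.
rewrite eq_le nm_ge0 andbT.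
apply: (@le0_small _ (nm (c *: x + y) + Normc.normc c * nm x + nm y)).
  by rewrite !addr_ge0 ?mulr_ge0 ?normc_ge0 ?nm_ge0.
move=> e e0; have [n hn] := nsmall e e0.
have limn z : nm (poly_op (p n) T z - S z) <= e * nm z.
  by rewrite (le_trans (lim n z))// ler_wpM2r ?nm_ge0.
have lp := bounded_op_linear (poly_op_bounded (p n) bT).
(* As p_n(T) is linear, the defect of linearity of [S] consists of three approximation errors. *)
have -> : S (c *: x + y) - (c *: S x + S y) =
   - (poly_op (p n) T (c *: x + y) - S (c *: x + y))
   + (c *: (poly_op (p n) T x - S x) + (poly_op (p n) T y - S y)).
  rewrite lp scalerBr addrACA -[in RHS]opprD addrA opprB -[RHS]addrA.
  by rewrite addrA subrK.
rewrite (le_trans (nmD _ _))// nmN mulrDr mulrDr -addrA lerD//.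
rewrite (le_trans (nmD _ _))// lerD// nmZ mulrCA ler_wpM2l ?normc_ge0//.
Qed.

End FixedOperator.
End FunctionalCalculus.

(** * Real powers of positive operators *)

Section OperatorPowers.
Context {R : realType} {H : hilbertType R}.
Implicit Types (x y z : H) (a t d e : R) (c : R[i]) (T S Q : H -> H) (p q : {poly R}).
Implicit Types (f g : R -> R).

Lemma uniform_cvg_ballP (K : numFieldType) (U : choiceType) (V : pseudoMetricType K)
    (A : set U) (u : nat -> U -> V) (l : U -> V) :
  {uniform A, u @ \oo --> l} <->
  forall e : K, 0 < e -> \forall n \near \oo, forall x : U, A x -> ball (l x) e (u n x).
Proof.
split=> [ul e e0|h P /uniform_nbhs[E [entE EP]]].
  apply: (ul [set h | forall x : U, A x -> ball (l x) e (h x)]).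
  apply/uniform_nbhs; exists [set xy | ball xy.1 e xy.2]; split=> //.
  by rewrite -entourage_ballE; exists e.
move: entE; rewrite -entourage_ballE => -[e /= e0 eE].
apply: filterS (h e e0) => n hn; apply: EP => y Ay; apply: eE; exact: hn.
Qed.

Lemma cfc_is_cfc f T S : bounded_op S ->
  (exists p : nat -> {poly R},
    {uniform [set t : R | spectrum T t%:C], (fun n t => (p n).[t]) @ \oo --> f} /\
    {uniform [set x : H | `|x| <= 1], (fun n => poly_op (p n) T) @ \oo --> S}) ->
  bounded_op T -> is_cfc f T S.
Proof.
move=> bS [p [/uniform_cvg_ballP pf /uniform_cvg_ballP pS]] bT; split=> // e e0.
have eC : 0 < e%:C by rewrite ltcR.
have [n [nf nS]] : exists n,
    (forall t, [set t : R | spectrum T t%:C] t -> ball (f t) e (p n).[t]) /\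
    (forall x : H, [set x : H | `|x| <= 1] x -> ball (S x) e%:C (poly_op (p n) T x)).
  by apply: (@filter_ex _ \oo); apply: filterI; [exact: pf | exact: pS].
exists (p n); split.
  by move=> t /nf; rewrite /ball/= distrC => /ltW.
move=> x; have [->|x0] := eqVneq x 0.
  rewrite (linop0 (bounded_op_linear bS)).
  rewrite (linop0 (bounded_op_linear (poly_op_bounded _ bT))).
  by rewrite subrr nm0 mulr0.
(* Convergence is only given on the closed unit ball, so x is normalized and the estimate scaled
   back. *)
have n0 := nm_gt0 x0; pose y := (nm x)^-1%:C *: x.
have xE : x = (nm x)%:C *: y.
  by rewrite /y scalerA -rmorphM mulfV ?gt_eqF// scale1r.
have : `|y| <= 1.
  by rewrite nmE /y nmZr gtr0_norm ?invr_gt0// mulVf ?gt_eqF.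
move=> /nS; rewrite -ball_normE /= nmE ltcR nmB => /ltW h.
rewrite {1 2}xE (linopZ (bounded_op_linear bS)).
rewrite (linopZ (bounded_op_linear (poly_op_bounded _ bT))) -scalerBr nmZr.
by rewrite gtr0_norm// mulrC ler_wpM2r// ltW.
Qed.

(** Approximants at precision 1/(n+1) show that the choice in [cfc] is made from a nonempty set; the
    chosen operator then equals S by uniqueness. *)
Lemma is_cfc_cfc f T S : bounded_op T -> symop T -> is_cfc f T S -> cfc f T = S.
Proof.
move=> bT sT hS; suff /= [bcfc hcfc] : [set S | bounded_op S /\ exists p : nat -> {poly R},
    {uniform [set t : R | spectrum T t%:C], (fun n t => (p n).[t]) @ \oo --> f} /\
    {uniform [set x : H | `|x| <= 1], (fun n => poly_op (p n) T) @ \oo --> S}] (cfc f T).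
  exact: (is_cfc_uniq bT sT (cfc_is_cfc bcfc hcfc bT)).
apply: xgetPex; exists S; case: hS => bS hS; split=> //.
have /choice[p hp] (n : nat) : exists p : {poly R},
    (forall t, spectrum T t%:C -> `|p.[t] - f t| <= n.+1%:R^-1) /\
    (forall x, nm (poly_op p T x - S x) <= n.+1%:R^-1 * nm x).
  by apply: hS; rewrite invr_gt0.
exists p; split; apply/uniform_cvg_ballP => e e0.
  have [N hN] := invS_small (divr_gt0 e0 (ltr0Sn R 1)).
  exists N => // n /hN hn t /(proj1 (hp n) t) ht; rewrite /ball/= distrC.
  by rewrite (le_lt_trans ht)// (le_lt_trans hn)// gtr_pMr// invf_lt1// ltr1n.
have e'0 : 0 < complex.Re e by move: e0; rewrite ltcE => /andP[].
have eE : e = (complex.Re e)%:C by rewrite RRe_real// gtr0_real.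
have [N hN] := invS_small (divr_gt0 e'0 (ltr0Sn R 1)).
exists N => // n /hN hn x /=; rewrite nmE lecR => x1.
rewrite -ball_normE /= nmE eE ltcR nmB (le_lt_trans (proj2 (hp n) x))//.
apply: (@le_lt_trans _ _ (complex.Re e / 2)); last by rewrite gtr_pMr// invf_lt1// ltr1n.
by rewrite -[leRHS]mulr1 ler_pM ?nm_ge0.
Qed.

Lemma positive_op_spectrum T : positive_op T ->
  exists2 M, 0 < M & forall t, spectrum T t%:C -> 0 <= t <= M.
Proof.
move=> [bT sT pT]; have [K K0 hK] := bounded_op_bound bT; exists K => // t.
apply: spectrum_bounds => // x; first by rewrite mul0r.
by rewrite (le_trans (rip_le _ _))// expr2 mulrA ler_wpM2r ?nm_ge0.
Qed.

Lemma op_powerP T a : positive_op T -> 0 <= a ->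
  is_cfc (fun t => t `^ a) T (op_power T a).
Proof.
move=> pT a0; have [M M0 hM] := positive_op_spectrum pT; have [bT sT _] := pT.
have [S hS] := is_cfc_exists bT sT M0 hM (powR_quad_continuous M a0).
by rewrite /op_power (is_cfc_cfc bT sT hS).
Qed.

Lemma positive_op_power T a : positive_op T -> 0 <= a -> positive_op (op_power T a).
Proof.
move=> pT a0; have hS := op_powerP pT a0; have [bT sT _] := pT; split.
- by case: hS.
- exact: is_cfc_sym hS.
- by apply: (is_cfc_ge0 bT sT hS) => t _; exact: powR_ge0.
Qed.

Lemma powR_norm_le (M a t : R) : 0 <= a -> 0 <= t <= M -> `|t `^ a| <= M `^ a.
Proof.
move=> a0 /andP[t0 tM]; rewrite ger0_norm ?powR_ge0//.
by rewrite ge0_ler_powR ?nnegrE// (le_trans t0).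
Qed.

Lemma poly_bounded p (M : R) : exists B, forall t, 0 <= t <= M -> `|p.[t]| <= B.
Proof.
elim/poly_ind: p => [|p c [B hB]]; first by exists 0 => t _; rewrite horner0 normr0.
exists (B * M + `|c|) => t tM; rewrite !hornerE (le_trans (ler_normD _ _))// lerD//.
have /andP[t0 t1] := tM; rewrite normrM (ger0_norm t0).
by rewrite ler_pM// hB.
Qed.

Lemma is_cfc_comp_poly f T S (B : R) p : bounded_op T ->
  (forall t, spectrum T t%:C -> 0 <= f t <= B) ->
  is_cfc f T S -> is_cfc (fun t => p.[f t]) T (poly_op p S).
Proof.
move=> bT hf hS; elim/poly_ind: p => [|p c IH].
  have := is_cfc_poly bT 0; rewrite (_ : poly_op 0 S = poly_op 0 T).
    by move=> h; apply: (is_cfc_ext h) => t _; rewrite !horner0.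
  by apply/funext => x; rewrite /poly_op size_poly0 !big_ord0.
rewrite (_ : poly_op _ S = fun x => (poly_op p S \o S) x + poly_op c%:P T x); last first.
  by apply/funext => x; rewrite poly_opD poly_opMX !poly_opC.
have [C hC] := poly_bounded p B.
have h1 t : spectrum T t%:C -> `|p.[f t]| <= C by move=> /hf; exact: hC.
have h2 t : spectrum T t%:C -> `|f t| <= B by move=> /hf /andP[? ?]; rewrite ger0_norm.
apply: is_cfc_ext (is_cfcD (is_cfcM bT h1 h2 IH hS) (is_cfc_poly bT c%:P)) _.
by move=> t _; rewrite !hornerE.
Qed.

(** [is_cfc_comp_poly] settles polynomials in T^a; t^b is then approximated by a polynomial. *)
Lemma op_power_power T a b : positive_op T -> 0 <= a -> 0 <= b ->
  op_power (op_power T a) b = op_power T (a * b).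
Proof.
move=> pT a0 b0; have pS := positive_op_power pT a0.
have hS := op_powerP pT a0; have hG := op_powerP pT (mulr_ge0 a0 b0).
have [M M0 hM] := positive_op_spectrum pT; have [M' M'0 hM'] := positive_op_spectrum pS.
have [bT sT _] := pT; have [bS sS _] := pS.
apply: is_cfc_cfc => //; split; first by case: hG.
(* [0, N] must contain both the spectrum of T^a and the values of t^a on the spectrum of T, as these
   are not known to coincide. *)
move=> e e0; pose N := Num.max M' (M `^ a).
have N0 : 0 < N by rewrite lt_max M'0.
have [p hp] := weierstrass N0 (powR_quad_continuous N b0) e0.
exists p; split.
  move=> t /hM' /andP[t0 tM]; apply: hp; rewrite t0 (le_trans tM)//.
  by rewrite le_max lexx.
have hf t : spectrum T t%:C -> 0 <= t `^ a <= M `^ a.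
  by move=> /hM tM; rewrite powR_ge0 (le_trans (ler_norm _))// powR_norm_le.
have hpS := @is_cfc_comp_poly _ _ _ _ p bT hf hS.
move=> x; apply: (is_cfc_le bT sT _ (is_cfcD hpS (is_cfcN hG))); first exact: ltW.
move=> t /hf /andP[h1 h2]; rewrite powRrM; apply: hp; rewrite h1 (le_trans h2)//.
by rewrite le_max lexx orbT.
Qed.

End OperatorPowers.

(** * Mixed Schwarz and McCarthy inequalities *)

Section OperatorInequalities.
Context {R : realType} {H : hilbertType R}.
Implicit Types (x y z k m : H) (a t d e : R) (T S Q X Y G B : H -> H).

Lemma positive_op_conj G B : positive_op G -> bounded_op B ->
  positive_op (adjoint B \o G \o B).
Proof.
move=> [bG sG pG] bB; split.
- apply: bounded_op_comp => //; apply: bounded_op_comp => //.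
  exact: bounded_op_adjoint.
- by move=> x y /=; rewrite inner_adjointl// sG inner_adjoint.
- by move=> x /=; rewrite /rip inner_adjointl//; exact: pG.
Qed.

Lemma positive_op_id : positive_op (id : H -> H).
Proof. by split => // [|x]; [exact: bounded_op_id | rewrite ripxx sqr_ge0]. Qed.

Lemma positive_op_gram X : bounded_op X -> positive_op (adjoint X \o X).
Proof. by move=> bX; apply: (positive_op_conj positive_op_id). Qed.

(** A single polynomial approximates f on both spectra, hence the common M; polynomials intertwine
    exactly. *)
Lemma is_cfc_intertwine (f : R -> R) T T' S S' Y (M : R) :
  bounded_op T -> symop T -> bounded_op T' -> symop T' -> bounded_op Y ->
  0 < M -> (forall t, spectrum T t%:C -> 0 <= t <= M) ->
  (forall t, spectrum T' t%:C -> 0 <= t <= M) -> quad_continuous M f ->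
  (forall x, Y (T x) = T' (Y x)) -> is_cfc f T S -> is_cfc f T' S' ->
  forall x, Y (S x) = S' (Y x).
Proof.
move=> bT sT bT' sT' bY M0 hM hM' qf YT hS hS' x.
have lY := bounded_op_linear bY; have [K K0 hK] := bounded_op_bound bY.
apply/eqP; rewrite -subr_eq0; apply/eqP/nm_eq0/eqP; rewrite eq_le nm_ge0 andbT.
apply: (@le0_small _ _ (K * nm x + nm (Y x))).
  by rewrite addr_ge0 ?mulr_ge0 ?nm_ge0// ltW.
move=> e e0; have [p hp] := weierstrass M0 qf e0.
have h1 : nm (poly_op p T x - S x) <= e * nm x.
  apply: (is_cfc_le bT sT _ (is_cfcD (is_cfc_poly bT p) (is_cfcN hS))); first exact: ltW.
  by move=> t /hM; exact: hp.
have h2 : nm (poly_op p T' (Y x) - S' (Y x)) <= e * nm (Y x).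
  apply: (is_cfc_le bT' sT' _ (is_cfcD (is_cfc_poly bT' p) (is_cfcN hS'))); first exact: ltW.
  by move=> t /hM'; exact: hp.
rewrite (le_trans (nm_triangle _ (Y (poly_op p T x)) _))// mulrDr lerD//; last first.
  by rewrite (poly_op_intertwine _ _ lY YT).
by rewrite nmB -linopB// (le_trans (hK _))// mulrCA ler_wpM2l// ltW.
Qed.

(** The power of [adjoint X \o X] need not be invertible, so it is shifted by e > 0. The resulting
    excess is e times a constant and is removed by [le0_small]. *)
Lemma mixed_schwarz X a x y : bounded_op X -> 0 <= a <= 1 ->
  Normc.normc (inner (X x) y) ^+ 2 <=
  rip (op_power (adjoint X \o X) a x) x * rip (op_power (X \o adjoint X) (1 - a) y) y.
Proof.
move=> bX /andP[a0 a1]; pose Z := adjoint X; have bZ : bounded_op Z := bounded_op_adjoint bX.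
pose T1 := Z \o X; pose T2 := X \o Z.
have p1 : positive_op T1 by exact: positive_op_gram.
have p2 : positive_op T2.
  by have := positive_op_gram bZ; rewrite /Z adjointK.
have [b1 s1 _] := p1; have [b2 s2 _] := p2.
have b0 : 0 <= 1 - a by rewrite subr_ge0.
rewrite -/Z -/T1 -/T2.
have g1 := op_powerP p1 a0; have g2 := op_powerP p2 b0.
set G1 := op_power T1 a in g1 *; set G2 := op_power T2 (1 - a) in g2 *.
have [M1 M10 hM1] := positive_op_spectrum p1; have [M2 M20 hM2] := positive_op_spectrum p2.
pose M := Num.max M1 M2; have M0 : 0 < M by rewrite lt_max M10.
have {}hM1 t : spectrum T1 t%:C -> 0 <= t <= M.
  by move=> /hM1 /andP[-> h]; rewrite (le_trans h)// le_max lexx.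
have {}hM2 t : spectrum T2 t%:C -> 0 <= t <= M.
  by move=> /hM2 /andP[-> h]; rewrite (le_trans h)// le_max lexx orbT.
have [_ _ pG2] : positive_op G2 by exact: positive_op_power.
rewrite -subr_le0; apply: (@le0_small _ _ (nm x ^+ 2 * rip (G2 y) y)).
  by rewrite mulr_ge0// sqr_ge0.
(* With U = u(Z X) and V = v(Z X) = U^-1, Cauchy-Schwarz for U bounds
   |<x, U V Z y>|^2 by <U x, x> <X V Z y, y>, and X V Z = (v t)(X Z) is at most
   (X Z)^(1 - a) because t / (t^a + e) <= t^(1 - a). *)
move=> e e0; pose u t := t `^ a + e; pose v t := (t `^ a + e)^-1.
have u0 t : 0 < u t by rewrite ltr_wpDl// powR_ge0.
have qv : quad_continuous M v.
  by apply: quad_continuous_inv => //; [move=> *; exact: powR_ge0|exact: powR_quad_continuous].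
pose U w := G1 w + poly_op e%:P T1 w.
have hU : is_cfc u T1 U.
  by apply: is_cfc_ext (is_cfcD g1 (is_cfc_poly b1 e%:P)) _ => t _; rewrite hornerC.
have [V hV] := is_cfc_exists b1 s1 M0 hM1 qv.
have [V2 hV2] := is_cfc_exists b2 s2 M0 hM2 qv.
have v_le t : `|v t| <= e^-1.
  have ut : 0 < t `^ a + e := u0 t.
  by rewrite /v gtr0_norm ?invr_gt0// lef_pV2 ?posrE// lerDr powR_ge0.
have UV w : U (V w) = w.
  have ub t : spectrum T1 t%:C -> `|u t| <= M `^ a + e.
    by move=> /hM1 tM; rewrite (le_trans (ler_normD _ _))// (gtr0_norm e0) lerD// powR_norm_le.
  have h1 : is_cfc (fun=> 1) T1 (U \o V).
    apply: is_cfc_ext (is_cfcM b1 ub (fun t _ => v_le t) hU hV) _ => t _.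
    by rewrite /v mulfV// gt_eqF.
  have h2 : is_cfc (fun=> 1) T1 (poly_op 1%:P T1).
    by apply: is_cfc_ext (is_cfc_poly b1 1%:P) _ => t _; rewrite hornerC.
  have /(congr1 (@^~ w)) := is_cfc_uniq b1 s1 h1 h2.
  by rewrite /= poly_opC scale1r.
have XV w : X (V w) = V2 (X w).
  by apply: (is_cfc_intertwine b1 s1 b2 s2 bX M0 hM1 hM2 qv _ hV hV2).
have sU := is_cfc_sym b1 s1 hU.
have pU : posop U by apply: (is_cfc_ge0 b1 s1 hU) => t _; exact: ltW.
have lU : linear U by case: hU => /bounded_op_linear.
have : Normc.normc (inner (X x) y) ^+ 2 <= rip (U x) x * rip (U (V (Z y))) (V (Z y)).
  by rewrite inner_adjoint// -/Z -{1}(UV (Z y)) -sU; exact: posop_cauchy_schwarzc.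
have -> : rip (U (V (Z y))) (V (Z y)) = rip (V2 (T2 y)) y.
  by rewrite UV /rip /Z inner_adjointl// -/(rip _ _) -/Z XV ripC.
have le2 : rip (V2 (T2 y)) y <= rip (G2 y) y.
  have hX : is_cfc (fun t => t) T2 T2.
    have := is_cfc_poly b2 'X; rewrite (_ : poly_op 'X T2 = T2); last first.
      by apply/funext => w; rewrite poly_opX.
    by move=> h; apply: is_cfc_ext h _ => t _; rewrite hornerX.
  have tb t : spectrum T2 t%:C -> `|t| <= M.
    by move=> /hM2 /andP[? ?]; rewrite ger0_norm.
  have hVT := is_cfcM b2 (fun t _ => v_le t) tb hV2 hX.
  have := is_cfc_ge0 b2 s2 (is_cfcD g2 (is_cfcN hVT)) _ y.
  rewrite ripDl ripNl subr_ge0; apply => t /hM2 /andP[t0 tM].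
  (* Valid at t = 0 too, because the exponents add up to 1. *)
  have tE : t = t `^ (1 - a) * t `^ a.
    by rewrite -powRD ?subrK ?powRr1// oner_eq0.
  rewrite subr_ge0 mulrC ler_pdivrMr; last exact: u0.
  by rewrite [leLHS]tE ler_wpM2l ?powR_ge0// lerDl ltW.
have -> : rip (U x) x = rip (G1 x) x + e * nm x ^+ 2.
  by rewrite /U poly_opC ripDl ripZ_scalar.
move=> h; rewrite lerBlDr (le_trans h)// mulrDl -mulrA addrC.
have G1x : 0 <= rip (G1 x) x by have [_ _] := positive_op_power p1 a0; apply.
rewrite lerD// !ler_wpM2l ?sqr_ge0// ltW//.
Qed.

(* A supporting line of the power function yields both the mean inequality and
   McCarthy's inequality. *)
Lemma powR_tangent (r c : R) : 1 <= r -> 0 <= c ->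
  exists s, forall t, 0 <= t -> c `^ r + s * (t - c) <= t `^ r.
Proof.
move=> r1; rewrite le_eqVlt => /orP[/eqP <-|c0].
  exists 0 => t t0; rewrite mul0r addr0 powR0 ?powR_ge0// gt_eqF//.
  by rewrite (lt_le_trans ltr01).
have c1 : 0 < c `^ r by exact: powR_gt0.
(* The derivative r c^(r - 1). The tangent at c is the tangent at 1 rescaled by u = t / c. *)
exists (r * c `^ r / c) => t t0.
have bern (u : R) : 0 <= u -> r * u - (r - 1) <= u `^ r.
  move=> u0; move: r1; rewrite le_eqVlt => /orP[/eqP <-|r1].
    by rewrite powRr1// subrr subr0 mul1r.
  have r0 : 0 < r by rewrite (lt_trans ltr01).
  have s0 : 0 < r - 1 by rewrite subr_gt0.
  (* Bernoulli's inequality is Young's inequality for u and 1 with exponents r and r / (r - 1). *)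
  have := @conjugate_powR R u 1 r (r / (r - 1)) u0 ler01 r0.
  rewrite divr_gt0// => /(_ isT); rewrite invf_div powR1 mulr1 mul1r => h.
  have /h {}h : r^-1 + (r - 1) / r = 1 by field; rewrite gt_eqF.
  by rewrite lerBlDr mulrC -ler_pdivlMr// (le_trans h)// -mulrDl.
have /bern : 0 <= t / c by rewrite divr_ge0// ltW.
move=> /(ler_wpM2l (ltW c1)); rewrite -powRM ?divr_ge0 ?(ltW c0)//.
rewrite (mulrC c) divfK ?gt_eqF//; apply: le_trans.
rewrite le_eqVlt; apply/orP; left; apply/eqP; field.
by rewrite gt_eqF.
Qed.

(** T^r dominates the tangent of the power at c = <T x, x>, evaluated at T; for a unit x its slope
    term vanishes at x. *)
Lemma mccarthy T r x : positive_op T -> 1 <= r -> nm x = 1 ->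
  rip (T x) x `^ r <= rip (op_power T r x) x.
Proof.
move=> pT r1 x1; have [bT sT pT'] := pT; have r0 : 0 <= r by rewrite (le_trans ler01).
set c := rip (T x) x; have [s hs] := powR_tangent r1 (pT' x).
have [M M0 hM] := positive_op_spectrum pT.
pose p : {poly R} := (c `^ r)%:P + s%:P * ('X - c%:P).
have := is_cfc_ge0 bT sT (is_cfcD (op_powerP pT r0) (is_cfcN (is_cfc_poly bT p))) _ x.
have -> : poly_op p T x = (c `^ r)%:C *: x + s%:C *: (T x - c%:C *: x).
  rewrite poly_opD poly_opM; last exact: bounded_op_linear.
  by rewrite poly_opD poly_opN poly_opX !poly_opC.
rewrite ripDl ripNl ripDl ripZl ripZl ripDl ripNl ripZl ripxx x1 expr1n !mulr1 subrr.
rewrite mulr0 addr0 subr_ge0; apply => t /hM /andP[t0 _].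
by rewrite /p !hornerE subr_ge0 hs.
Qed.

(** In the tangent inequalities at the midpoint, the slope terms for a and b cancel. *)
Lemma powR_mean (r a b : R) : 1 <= r -> 0 <= a -> 0 <= b ->
  ((a + b) / 2) `^ r <= (a `^ r + b `^ r) / 2.
Proof.
move=> r1 a0 b0; have c0 : 0 <= (a + b) / 2 by rewrite divr_ge0// addr_ge0.
have [s hs] := powR_tangent r1 c0; have := hs a a0; have := hs b b0.
move: (((a + b) / 2) `^ r) (a `^ r) (b `^ r) => u v w; lra.
Qed.

End OperatorInequalities.

(** * Berezin number and norm *)

Section BerezinBounds.
Context {R : realType} {Omega : Type} {H : rkhsType R Omega}.
Implicit Types (T : H -> H) (l m : Omega).

Lemma nm_normalized_kernel l : rep_kernel l != 0 :> H ->
  nm (normalized_kernel l : H) = 1.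
Proof.
move=> k0; apply: complexI; rewrite -nmE /normalized_kernel normrZ normfV normr_id.
by rewrite mulVf// normr_eq0.
Qed.

(** Boundedness of T and unit kernels bound the set above, without which [sup] gives no estimate. *)
Lemma le_berezin_number T l : (forall l, rep_kernel l != 0 :> H) -> bounded_op T ->
  rip (T (normalized_kernel l)) (normalized_kernel l) <= berezin_number T.
Proof.
move=> k0 bT; have [K K0 hK] := bounded_op_bound bT.
apply: le_trans (le_trans (ler_norm _) (Re_le_normc _)) _.
apply: ub_le_sup; last by exists l.
exists K => _ [m _ <-].
rewrite (le_trans (normc_inner_le _ _))// (nm_normalized_kernel (k0 m)) mulr1.
by rewrite (le_trans (hK _))// (nm_normalized_kernel (k0 m)) mulr1.
Qed.

Lemma sqr_berezin_norm_le T (c : R) : inhabited Omega -> 0 <= c ->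
  (forall l m, Normc.normc
    (inner (T (normalized_kernel l)) (normalized_kernel m : H)) ^+ 2 <= c) ->
  berezin_norm T ^+ 2 <= c.
Proof.
move=> [l0] c0 hc; rewrite -(sqr_sqrtr c0).
have ub : ubound [set Normc.normc (inner (T (normalized_kernel l)) (normalized_kernel m : H))
    | l in [set: Omega] & m in [set: Omega]] (Num.sqrt c).
  move=> _ [l _ [m _ <-]].
  by rewrite -(@ler_pXn2r _ 2)// ?nnegrE ?normc_ge0 ?sqrtr_ge0// sqr_sqrtr.
have mem0 : [set Normc.normc (inner (T (normalized_kernel l)) (normalized_kernel m : H))
    | l in [set: Omega] & m in [set: Omega]]
    (Normc.normc (inner (T (normalized_kernel l0)) (normalized_kernel l0 : H))).
  by exists l0 => //; exists l0.
rewrite ler_pXn2r ?nnegrE ?sqrtr_ge0//.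
  by apply: ge_sup => //; exists (Normc.normc
    (inner (T (normalized_kernel l0)) (normalized_kernel l0 : H))).
(* Squaring is monotone only on nonnegative numbers; the supremum is one because a point of [Omega]
   gives a nonnegative entry. *)
apply: le_trans (normc_ge0 _) _; apply: ub_le_sup mem0.
by exists (Num.sqrt c).
Qed.

Lemma powR_mean_le_berezin (P Q : H -> H) (r : R) l :
  (forall l, rep_kernel l != 0 :> H) -> positive_op P -> positive_op Q -> 1 <= r ->
  (rip (P (normalized_kernel l)) (normalized_kernel l)
   + rip (Q (normalized_kernel l)) (normalized_kernel l)) / 2
  <= berezin_number (2^-1 *: (op_power P r + op_power Q r)) `^ r^-1.
Proof.
move=> k0 pP pQ r1; have r0 : 0 < r by rewrite (lt_le_trans ltr01).
set k := normalized_kernel l; have k1 : nm k = 1 by exact: nm_normalized_kernel.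
have [bP _ _] := positive_op_power pP (ltW r0).
have [bQ _ _] := positive_op_power pQ (ltW r0).
have P0 : 0 <= rip (P k) k by case: pP => _ _; apply.
have Q0 : 0 <= rip (Q k) k by case: pQ => _ _; apply.
have c0 : 0 <= (rip (P k) k + rip (Q k) k) / 2 by rewrite divr_ge0// addr_ge0.
have bT : bounded_op (2^-1 *: (op_power P r + op_power Q r)).
  exact: (bounded_op_scale (2^-1) (bounded_op_add bP bQ)).
have h : ((rip (P k) k + rip (Q k) k) / 2) `^ r <=
    berezin_number (2^-1 *: (op_power P r + op_power Q r)).
  apply: le_trans (powR_mean r1 P0 Q0) _; apply: le_trans (le_berezin_number l k0 bT).
  rewrite -/k (_ : (2^-1 *: _) k = (2^-1)%:C *: (op_power P r k + op_power Q r k)); last first.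
    by rewrite fmorphV rmorphMn.
  rewrite ripZl ripDl mulrC ler_wpM2l ?invr_ge0// lerD// mccarthy//.
have b0 := le_trans (powR_ge0 _ _) h.
have -> : (rip (P k) k + rip (Q k) k) / 2 =
    (((rip (P k) k + rip (Q k) k) / 2) `^ r) `^ r^-1.
  by rewrite -powRrM mulfV ?gt_eqF// powRr1.
by apply: ge0_ler_powR; rewrite ?nnegrE ?invr_ge0 ?powR_ge0 ?(ltW r0).
Qed.

End BerezinBounds.

Lemma sqr_mean_le (R : realType) (n1 n2 a1 a2 b1 b2 : R) :
  0 <= n1 -> 0 <= n2 -> 0 <= a1 -> 0 <= a2 -> 0 <= b1 -> 0 <= b2 ->
  n1 ^+ 2 <= a1 * a2 -> n2 ^+ 2 <= b1 * b2 ->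
  ((n1 + n2) / 2) ^+ 2 <= (a1 + b1) / 2 * ((a2 + b2) / 2).
Proof.
move=> n10 n20 a10 a20 b10 b20 h1 h2.
(* Arithmetic-geometric mean for a1 b2 and b1 a2, proved after squaring to avoid roots. *)
have cross : 2 * (n1 * n2) <= a1 * b2 + b1 * a2.
  rewrite -(@ler_pXn2r _ 2)// ?nnegrE ?addr_ge0 ?mulr_ge0//.
  have h : (n1 * n2) ^+ 2 <= (a1 * a2) * (b1 * b2).
    by rewrite exprMn ler_pM ?sqr_ge0.
  have := sqr_ge0 (a1 * b2 - b1 * a2); move: h; nra.
nra.
Qed.

Theorem theorem2p4 (R : realType) (Omega : Type) (H : rkhsType R Omega)
    (Omega_nonempty : inhabited Omega)
    (rep_kernel_neq0 : forall l : Omega, rep_kernel l != 0 :> H)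
    (A B C D X Y : H -> H)
    (hA : bounded_op A) (hB : bounded_op B) (hC : bounded_op C)
    (hD : bounded_op D) (hX : bounded_op X) (hY : bounded_op Y)
    (alpha : R) (halpha : 0 <= alpha <= 1)
    (r s : R) (hr : 1 <= r) (hs : 1 <= s) :
  berezin_norm (2^-1 *: ((adjoint A \o X \o B) + (adjoint C \o Y \o D))) ^+ 2
  <= berezin_number
       (2^-1 *: (op_power (adjoint B \o op_power (op_abs X) (2 * alpha) \o B) r
               + op_power (adjoint D \o op_power (op_abs Y) (2 * alpha) \o D) r))
       `^ r^-1
   * berezin_number
       (2^-1 *: (op_power (adjoint A \o op_power (op_abs (adjoint X)) (2 * (1 - alpha)) \o A) s
               + op_power (adjoint C \o op_power (op_abs (adjoint Y)) (2 * (1 - alpha)) \o C) s))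
       `^ s^-1.
Proof.
have /andP[al0 al1] := halpha.
have al1' : 0 <= 1 - alpha by rewrite subr_ge0.
(* The exponent 1/2 of the absolute value cancels the factor 2. *)
have abs_power (T : H -> H) a : bounded_op T -> 0 <= a ->
    op_power (op_abs T) (2 * a) = op_power (adjoint T \o T) a.
  move=> bT a0; rewrite /op_abs op_power_power ?mulr_ge0 ?invr_ge0//.
    by rewrite mulKf.
  exact: positive_op_gram.
have bX' := bounded_op_adjoint hX; have bY' := bounded_op_adjoint hY.
rewrite !abs_power// !adjointK//.
have pos (T S : H -> H) a : bounded_op T -> bounded_op S -> 0 <= a ->
    positive_op (adjoint S \o op_power (adjoint T \o T) a \o S).
  move=> bT bS a0; apply: positive_op_conj => //; apply: positive_op_power => //.
  exact: positive_op_gram.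
have pos' (T S : H -> H) a : bounded_op T -> bounded_op S -> 0 <= a ->
    positive_op (adjoint S \o op_power (T \o adjoint T) a \o S).
  by move=> bT bS a0; have := pos _ S a (bounded_op_adjoint bT) bS a0; rewrite adjointK.
apply: sqr_berezin_norm_le => //; first by rewrite mulr_ge0 ?powR_ge0.
move=> l m.
(* The kernel at [l] meets only B and D, the one at [m] only A and C, so the two Berezin numbers are
   reached independently. *)
have h1 := powR_mean_le_berezin l rep_kernel_neq0
  (pos X B _ hX hB al0) (pos Y D _ hY hD al0) hr.
have h2 := powR_mean_le_berezin m rep_kernel_neq0
  (pos' X A _ hX hA al1') (pos' Y C _ hY hC al1') hs.
set k := normalized_kernel l in h1 *; set j := normalized_kernel m in h2 *.
clearbody k j.
have nonneg (T : H -> H) x : positive_op T -> 0 <= rip (T x) x by case=> _ _; apply.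
have adj (S G : H -> H) x : bounded_op S -> rip ((adjoint S \o G \o S) x) x = rip (G (S x)) (S x).
  by move=> bS; rewrite /rip /= inner_adjointl.
set n1 := Normc.normc (inner (X (B k)) (A j)).
set n2 := Normc.normc (inner (Y (D k)) (C j)).
have le_n : Normc.normc (inner ((2^-1 *: ((adjoint A \o X \o B) + (adjoint C \o Y \o D))) k) j)
    <= (n1 + n2) / 2.
  have -> : (2^-1 *: ((adjoint A \o X \o B) + (adjoint C \o Y \o D))) k =
      (2^-1)%:C *: (adjoint A (X (B k)) + adjoint C (Y (D k))).
    by rewrite fmorphV rmorphMn.
  rewrite innerZl Normc.normcM normc_real ger0_norm ?invr_ge0// mulrC.
  rewrite ler_wpM2r ?invr_ge0// innerDl (le_trans (le_normcD _ _))//.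
  by rewrite !inner_adjointl.
have q1 := mixed_schwarz (B k) (A j) hX halpha.
have q2 := mixed_schwarz (D k) (C j) hY halpha.
rewrite -(adj B)// -(adj A)// in q1; rewrite -(adj D)// -(adj C)// in q2.
have a1 := nonneg _ k (pos X B _ hX hB al0); have b1 := nonneg _ k (pos Y D _ hY hD al0).
have a2 := nonneg _ j (pos' X A _ hX hA al1'); have b2 := nonneg _ j (pos' Y C _ hY hC al1').
have q := sqr_mean_le (normc_ge0 _) (normc_ge0 _) a1 a2 b1 b2 q1 q2.
apply: le_trans (le_trans q _).
  by rewrite ler_pXn2r ?nnegrE ?normc_ge0// divr_ge0// addr_ge0 ?normc_ge0.
exact: (ler_pM (divr_ge0 (addr_ge0 a1 b1) (ler0n _ 2)) (divr_ge0 (addr_ge0 a2 b2) (ler0n _ 2))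
  h1 h2).
Qed.
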